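(* Let $p \geq 3$ be a prime and let $G$ be a finite $\mathrm{Qd}(p)$-free group with characteristic $p$. Let $S$ be a $p$-subgroup of $G$ with $O_p(G) \leq S$. Then $K^{\infty}(S) \trianglelefteq G$.
   Context: All groups are finite. A group $G$ has characteristic $p$ if $C_G(O_p(G)) \leq O_p(G)$. The group $\mathrm{Qd}(p)$ is the semidirect product of $\mathrm{SL}_2(p)$ with its natural module (the $2$-dimensional space over the field of $p$ elements). $G$ is $\mathrm{Qd}(p)$-free if there are no subgroups $K \trianglelefteq H \leq G$ with $H/K \cong \mathrm{Qd}(p)$. For a group $S$, let $\mathrm{sgp}(S)$ denote the set of all subgroups of $S$. For $\Sigma \subseteq \mathrm{sgp}(S)$, write $B \leq\in \Sigma$ to mean that $B$ is a subgroup of some member of $\Sigma$. Commutators are left-normed: $[A,B,B] = [[A,B],B]$. Definition of $\mathcal{K}(-,-)$: for a $p$-group $S$ and $\Sigma \subseteq \mathrm{sgp}(S)$, $\mathcal{K}(S,\Sigma)$ is the set of all $A \in \mathrm{sgp}(S)$ such that (i) $A$ has nilpotency class at most two (i.e. $[A,A] \leq Z(A)$); (ii) $A$ is normalized by each member of $\Sigma$; (iii) whenever $B \leq\in \Sigma$ satisfies $[A,B,B] \leq Z(A)$, then $[A,B] \leq Z(A)$. Define $\mathcal{K}_0(S) = \mathrm{sgp}(S)$ and $\mathcal{K}_{i+1}(S) = \mathcal{K}(S,\mathcal{K}_i(S))$ for all $i \geq 0$; $\mathcal{K}^{\infty}(S) = \bigcap_{i \text{ even}} \mathcal{K}_i(S)$;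 and $K^{\infty}(S) = \langle\, \mathcal{K}^{\infty}(S)\,\rangle$, the subgroup of $S$ generated by all members of $\mathcal{K}^{\infty}(S)$. *)

(* Defs.v *)
From mathcomp Require Import all_boot all_order all_algebra.
From mathcomp Require Import all_fingroup all_solvable all_character.
From mathcomp Require Import boolp.

Set Implicit Arguments.
Unset Strict Implicit.
Unset Printing Implicit Defensive.

Local Open Scope group_scope.

Section Qd.

Variable p : nat.

Definition SL2 : {set {'GL_2['F_p]}} := [set x | (\det (GLval x) == 1)%R].

Fact SL2_group_set : group_set SL2.
Proof.
apply/group_setP; split=> [|x y]; first by rewrite inE GL_1E matrix.det1.
rewrite !inE GL_ME => /eqP dx /eqP dy.
by rewrite -matrix.mulmxE matrix.det_mulmx dx dy GRing.mulr1.
Qed.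
Canonical SL2_group := Group SL2_group_set.

(* GLrepr F n.-1 is the tautological representation of 'GL_n[F]. *)
Definition SL2_natural_repr :=
  subg_repr (GLrepr 'F_p 1) (subsetT SL2_group).

(* SL_2(p) acts by right multiplication on the row vectors 'rV['F_p]_2;
   for p not prime, 'F_p is the field of order the least prime factor of p. *)
Definition Qd := sdprod_by ('MR SL2_natural_repr)%gact.

End Qd.

Section Group.

Variable gT : finGroupType.
Implicit Types (A B C G H K S : {group gT}) (Sigma : {set {group gT}}).

Definition has_characteristic (p : nat) G : Prop :=
  'C_G('O_p(G)) \subset 'O_p(G).

Definition Qd_free (p : nat) G : Prop :=
  forall K H, K <| H -> H \subset G -> ~ (H / K \isog [set: Qd p]).

Definition sub_member B Sigma : bool := [exists C in Sigma, B \subset C].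

(* nil_class A <= 2 is equivalent to A^`(1) \subset 'Z(A) for every A
   (nil_class2), so nilpotency need not be required separately. *)
Definition Kop S Sigma : {set {group gT}} :=
  [set A in subgroups S |
    [&& nil_class A <= 2,
        [forall B in Sigma, B \subset 'N(A)] &
        [forall B : {group gT}, sub_member B Sigma ==>
           ([~: A, B, B] \subset 'Z(A)) ==> ([~: A, B] \subset 'Z(A))]]].

Fixpoint Kseq S (i : nat) : {set {group gT}} :=
  if i is j.+1 then Kop S (Kseq S j) else subgroups S.

(* The intersection over all even i; asbool turns the quantification over the
   infinite set of even i into a boolean, as required by {set _}. *)
Definition Kinfty_set S : {set {group gT}} :=
  [set A : {group gT} | `[< forall i : nat, ~~ odd i -> A \in Kseq S i >]].

Definition Kinfty S : {set gT} := << \bigcup_(A in Kinfty_set S) A >>.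

Canonical Kinfty_group S := Eval hnf in [group of Kinfty S].

End Group.

(* Main.v *)
Require Import Defs.
From mathcomp Require Import all_boot all_fingroup all_solvable.
From mathcomp Require Import all_order all_algebra all_field all_character.
From mathcomp Require Import ring zify.
From mathcomp Require boolp.

(** Both applications of K to the limit set return it, so it suffices to show
that every A in K^oo(S) lies in Q = O_p(G): then K^oo(S) and K^oo(Q) are the
same set, and the latter is invariant under N(Q).

If A is not contained in Q, let N be generated by the p'-elements of the normal
closure of A. A minimal G-invariant C <= Q with [C, N] != 1 has all its proper
G-invariant subgroups central. By p-stability C belongs to K(S, K^oo(S)), so A
satisfies the defining condition of K with respect to C; a three subgroup
argument and p-stability again put the image of A in O_p(G / C(C)), whence N
centralises C, a contradiction.

p-stability of Qd(p)-free groups comes from the Baer-Suzuki theorem and a study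
of two elements x, y acting quadratically on an elementary abelian E. If
(x - 1)(y - 1) is nilpotent then <x, y> acts as a p-group. Otherwise an
eigenvector over a splitting field spans with its image under x - 1 a plane on
which <x, y> induces transvections. Adding the scalars, we get a subgroup of
GL_2(F) each of whose elements has an eigenvector in F^2, and a count of orbits
on nonzero vectors (a weak form of Dickson's theorem) provides h in it such that
h_21^2 / det h lies in the prime field. The transvection x and a power of x^h
then generate SL_2(p) on an F_p-form of the plane; pushing this form down to E by
an F_p-linear form on F and splitting with a Sylow 2-normaliser gives a section
isomorphic to Qd(p). *)

Set Implicit Arguments.
Unset Strict Implicit.
Unset Printing Implicit Defensive.

(** Two transvections of a plane with distinct fixed lines become, in a suitable basis,
    [mx2 1 1 0 1] and [mx2 1 0 m 1]. The parameter m is an invariant of the pair, since the product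
    has trace 2 + m. The pair x, y has m = mu, an eigenvalue that may lie outside the prime field,
    and then SL_2(p) is not visible on x and y themselves. For x and x^h the parameter is - h_21^2 /
    det h, and replacing x^h by its i-th power multiplies it by i. So the search is for an h whose
    parameter lies in the prime field. The field F contains enough roots of unity to give every
    element of the group an eigenvector. Elements without eigenlines therefore never occur, and
    counting pairs (element, eigenvector) needs no further case. When p = 3 the count leaves an
    exceptional configuration, of the type SL_2(5) in SL_2(9), which needs separate computations. *)

Local Open Scope group_scope.

(** * The operator K *)

Section Kseries.

Import boolp.

Variable gT : finGroupType.
Implicit Types (A B C S Q : {group gT}) (Sigma Tau : {set {group gT}}).

Lemma KopP S Sigma A : reflect
  [/\ A \subset S, nil_class A <= 2,
      forall B, B \in Sigma -> B \subset 'N(A) &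
      forall B C, C \in Sigma -> B \subset C ->
        [~: A, B, B] \subset 'Z(A) -> [~: A, B] \subset 'Z(A)]
  (A \in Kop S Sigma).
Proof.
rewrite !inE; apply: (iffP and4P) => [[-> -> nA qA]|[-> -> nA qA]].
  split=> // [B SB|B C SC sBC qAB]; first exact: (implyP (forallP nA B)).
  have sB: sub_member B Sigma by apply/existsP; exists C; rewrite SC.
  exact: implyP (implyP (forallP qA B) sB) qAB.
split=> //; first by apply/forallP=> B; apply/implyP/nA.
apply/forallP=> B; apply/implyP=> /existsP[C /andP[SC sBC]].
by apply/implyP; apply: qA SC sBC.
Qed.

Lemma Kop_anti S Sigma Tau : Sigma \subset Tau -> Kop S Tau \subset Kop S Sigma.
Proof.
move=> sST; apply/subsetP=> A /KopP[sA cA nA qA]; apply/KopP; split=> // [B SB|B C SC].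
  exact/nA/(subsetP sST).
exact/qA/(subsetP sST).
Qed.

Lemma Kseq_parity S i :
  if odd i then Kseq S i \subset Kseq S i.+1 else Kseq S i.+1 \subset Kseq S i.
Proof.
elim: i => [|i IHi]; first by apply/subsetP=> A /KopP[sAS _ _ _]; rewrite inE.
rewrite [odd _]/=; case: (odd i) IHi => /= IHi; apply: Kop_anti IHi.
Qed.

Lemma Kseq_even_anti S i j : i <= j -> Kseq S j.*2 \subset Kseq S i.*2.
Proof.
move/subnK<-; elim: (j - i) => // k; apply: subset_trans.
rewrite addSn; elim: (k + i) => [|l IHl]; last by apply/Kop_anti/Kop_anti.
by apply/subsetP=> A /KopP[sAS _ _ _]; rewrite inE.
Qed.

(** The even terms decrease and S has finitely many subgroups. Hence the largest of the indices at
    which the various subgroups drop out already gives the limit. *)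
Lemma Kinfty_set_Kseq S : exists i, Kinfty_set S = Kseq S i.*2.
Proof.
have ex (A : {group gT}) : exists i, (A \notin Kinfty_set S) ==> (A \notin Kseq S i.*2).
  have [//|] := boolP (A \in Kinfty_set S); first by exists 0.
  rewrite inE => /asboolPn/existsNP[i]; rewrite not_implyE => -[ev_i /negP NA].
  by exists i./2; rewrite even_halfK.
pose m (A : {group gT}) := xchoose (ex A); exists (\max_A m A).
apply/setP=> A; apply/idP/idP => [|KA].
  by rewrite inE => /asboolP-> //; rewrite odd_double.
apply: contraLR KA => NA; have /implyP/(_ NA) := xchooseP (ex A).
by apply/contra/subsetP/Kseq_even_anti/leq_bigmax.
Qed.

Lemma Kop_Kinfty_set S : Kop S (Kinfty_set S) \subset Kinfty_set S.
Proof. by have [i ->] := Kinfty_set_Kseq S; have := Kseq_parity S i.*2; rewrite odd_double. Qed.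

Lemma Kinfty_set_fix S : Kop S (Kop S (Kinfty_set S)) = Kinfty_set S.
Proof.
have [i def_i] := Kinfty_set_Kseq S; apply/eqP; rewrite eqEsubset; apply/andP; split.
  by rewrite {2}def_i def_i; apply: Kseq_even_anti (leqnSn i).
apply/subsetP=> A; rewrite inE => /asboolP/(_ i.+1.*2); rewrite odd_double => /(_ isT).
by rewrite def_i.
Qed.

(** [Kop S] reverses inclusions, so its square is monotone, and the limit set is the largest set
    contained in its own image under that square. *)
Lemma sub_Kinfty_set S Sigma :
  Sigma \subset Kop S (Kop S Sigma) -> Sigma \subset Kinfty_set S.
Proof.
move=> sS; have [i ->] := Kinfty_set_Kseq S.
elim: i => [|i IHi]; last by apply: (subset_trans sS); apply/Kop_anti/Kop_anti.
by apply: (subset_trans sS); apply/subsetP=> A /KopP[sAS _ _ _]; rewrite inE.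
Qed.

Lemma KopI S Q Sigma :
  Q \subset S -> Kop Q Sigma = Kop S Sigma :&: subgroups Q.
Proof.
move=> sQS; apply/setP=> A; rewrite in_setI [A \in subgroups Q]inE.
apply/KopP/andP => [[sAQ cA nA qA]|[/KopP[_ cA nA qA]] sAQ]; last by [].
by split=> //; apply/KopP; split=> //; apply: subset_trans sQS.
Qed.

(** [Kop Q] and [Kop S] agree wherever the values of [Kop S] consist of subgroups of Q. This holds
    at both limit sets, so each of them is a fixed point of the square of the other operator, and
    [sub_Kinfty_set] gives the two inclusions. *)
Lemma Kinfty_set_restrict S Q :
    Q \subset S -> (forall A, A \in Kinfty_set S -> A \subset Q) ->
  Kinfty_set S = Kinfty_set Q.
Proof.
move=> sQS KsQ; have sAQ : Kinfty_set S \subset subgroups Q.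
  by apply/subsetP=> A /KsQ; rewrite inE.
have sBA := Kop_Kinfty_set S.
have eq_f Sigma : Kop S Sigma \subset subgroups Q -> Kop Q Sigma = Kop S Sigma.
  by move=> sQ; rewrite (KopI _ sQS) (setIidPl sQ).
have fA : Kop Q (Kinfty_set S) = Kop S (Kinfty_set S).
  exact/eq_f/(subset_trans sBA).
have sSQ : Kinfty_set S \subset Kinfty_set Q.
  by apply: sub_Kinfty_set; rewrite fA eq_f Kinfty_set_fix.
have fQ : Kop Q (Kinfty_set Q) = Kop S (Kinfty_set Q).
  apply: eq_f; apply: subset_trans sAQ; rewrite -[Kinfty_set S]Kinfty_set_fix.
  exact/Kop_anti/(subset_trans sBA).
apply/eqP; rewrite eqEsubset sSQ sub_Kinfty_set // -fQ.
rewrite -{1}[Kinfty_set Q]Kinfty_set_fix (KopI _ sQS); exact: subsetIl.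
Qed.

Lemma mem_Kinfty_sub S A : A \in Kinfty_set S -> A \subset S.
Proof. by rewrite inE => /asboolP/(_ 0 isT); rewrite inE. Qed.

Lemma Kseq_conj S i A x :
  x \in 'N(S) -> A \in Kseq S i -> (A :^ x)%G \in Kseq S i.
Proof.
elim: i A x => [|i IHi] A x nSx; first by rewrite !inE -{2}(normP nSx) conjSg.
have nSx' : x^-1 \in 'N(S) by rewrite groupV.
case/KopP=> sAS cA nA qA; apply/KopP; split=> [||B SB|B C SC sBC].
- by rewrite -(normP nSx) conjSg.
- by rewrite /= -(isog_nil_class (conj_isog A x)).
- by have := nA _ (IHi B _ nSx' SB); rewrite /= normJ sub_conjgV.
have defB : B :=: (B :^ x^-1)%G :^ x by rewrite /= conjsgKV.
rewrite defB /= -!conjsRg /center centJ -conjIg !conjSg.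
by apply: qA (IHi C _ nSx' SC) _; rewrite conjSg.
Qed.

Lemma Kinfty_norm S : 'N(S) \subset 'N(Kinfty S).
Proof.
rewrite norms_gen //; apply/subsetP=> x nSx; rewrite inE.
apply/subsetP=> _ /imsetP[y /bigcupP[A KA Ay] ->]; apply/bigcupP.
exists (A :^ x)%G; last by rewrite memJ_conjg.
have [i def_i] := Kinfty_set_Kseq S; rewrite def_i in KA *; exact: Kseq_conj.
Qed.

Lemma Kinfty_sub S : Kinfty S \subset S.
Proof. by rewrite gen_subG; apply/bigcupsP=> A; apply: mem_Kinfty_sub. Qed.

End Kseries.

(** * The subgroup generated by the p-prime elements *)

Definition Oup (p : nat) (gT : finGroupType) (K : {set gT}) : {set gT} :=
  <<[set x in K | p^'.-elt x]>>.
Canonical Oup_group p gT K := Eval hnf in [group of @Oup p gT K].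

Section PResidual.

Variables (p : nat) (gT : finGroupType).
Implicit Types (A C G H K M N U W X Y : {group gT}).

Lemma Oup_sub K : Oup p K \subset K.
Proof. by rewrite gen_subG; apply/subsetP=> x; rewrite inE => /andP[]. Qed.

Lemma mem_Oup K x : x \in K -> p^'.-elt x -> x \in Oup p K.
Proof. by move=> Kx p'x; rewrite mem_gen // inE Kx. Qed.

Lemma Oup_subP K H :
  reflect {in K, forall x, p^'.-elt x -> x \in H} (Oup p K \subset H).
Proof.
rewrite gen_subG; apply: (iffP subsetP) => [sH x Kx p'x | sH x].
  by rewrite sH // inE Kx.
by rewrite inE => /andP[]; apply: sH.
Qed.

Lemma Oup_norm K : 'N(K) \subset 'N(Oup p K).
Proof.
rewrite norms_gen //; apply/subsetP=> x nKx; rewrite inE.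
apply/subsetP=> _ /imsetP[y /[!inE]/andP[Ky p'y] ->].
by rewrite memJ_norm // Ky p_eltJ.
Qed.

Lemma Oup_normal K : Oup p K <| K.
Proof. by rewrite /normal Oup_sub (subset_trans (normG K) (Oup_norm K)). Qed.

(** This identifies [Oup p K] with O^p(K), the least normal subgroup of K with a p-group as
    quotient. H is only normalised by K, so that centralisers can be taken for H. *)
Lemma Oup_sub_quo K H : K \subset 'N(H) -> (Oup p K \subset H) = p.-group (K / H).
Proof.
move=> nHK; apply/Oup_subP/idP => [sH | pKH x Kx p'x].
  rewrite /pgroup -pgroupE; apply/pgroupP=> q q_pr /Cauchy[//|xb].
  case/morphimP=> x nHx Kx -> {xb} oxq.
  have Hx' : x.`_p^' \in H by rewrite sH ?groupX // p_elt_constt.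
  have: p.-elt (coset H x).
    rewrite -[x](consttC p) morphM ?groupX //= (coset_id Hx') mulg1.
    by rewrite morph_p_elt ?groupX // p_elt_constt.
  by rewrite /p_elt oxq pnatE.
have nHx := subsetP nHK x Kx; apply: coset_idr => //; apply/eqP.
rewrite -order_eq1 (@pnat_1 p #[coset H x]) //; first exact: mem_p_elt pKH (mem_quotient _ Kx).
exact: morph_p_elt.
Qed.

Lemma Oup1_pgroup K : (Oup p K \subset [1]) = p.-group K.
Proof. by rewrite Oup_sub_quo ?norms1 // (isog_pgroup p (quotient1_isog K)). Qed.

Lemma Oup_pgroup_quo K : p.-group (K / Oup p K).
Proof. by rewrite -Oup_sub_quo ?normal_norm ?Oup_normal. Qed.

(** If y is a p'-element, then [c, y] commutes with y, so [c, y^k] = [c, y]^k. At k = #[y] the order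
    of [c, y] is seen to be prime to p, while [c, y] lies in the p-group C. *)
Lemma coprime_cent_Oup C K :
    p.-group C -> K \subset 'N(C) -> [~: C, Oup p K, Oup p K] = 1 ->
  [~: C, Oup p K] = 1.
Proof.
move=> pC nCK CNN; apply/commG1P; rewrite centsC; apply/Oup_subP=> y Ky p'y.
have Ny := mem_Oup Ky p'y; apply/centP=> c Cc; apply/esym/commgP.
have Cd : [~ c, y] \in C.
  by rewrite commgEl groupM ?groupV // memJ_norm // (subsetP nCK).
have cyd : commute y [~ c, y].
  apply/commute_sym/commgP; have: [~ c, y, y] \in [~: C, Oup p K, Oup p K].
    by rewrite !mem_commg.
  by rewrite CNN inE.
have := commgX #[y] cyd; rewrite expg_order commg1 => /esym/eqP; rewrite -order_dvdn => dy.
rewrite -order_eq1 (@pnat_1 p #[[~ c, y]]) //; first exact: mem_p_elt pC Cd.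
exact: pnat_dvd dy p'y.
Qed.

(** * Minimal invariant p-subgroups that O^p(K) does not centralise *)

Section MinimalNoncentral.

Variables X K C : {group gT}.
Local Notation N := (Oup p K).
Hypotheses (pC : p.-group C) (sCX : C \subset X) (nCX : X \subset 'N(C)) (sKX : K \subset X).
Hypothesis nNX : X \subset 'N(N).
Hypothesis ntN : [~: C, N] != 1.
Hypothesis minC : forall C1, C1 \proper C -> X \subset 'N(C1) -> [~: C1, N] = 1.

Let nCK : K \subset 'N(C). Proof. exact: subset_trans nCX. Qed.
Let nCN : N \subset 'N(C). Proof. exact: subset_trans (Oup_sub K) nCK. Qed.

Lemma min_noncentral_comm : [~: C, N] = C.
Proof.
apply/eqP; rewrite eqEproper commg_subl nCN /=; apply/negP=> prC1.
have CNN : [~: C, N, N] = 1 by apply: minC; rewrite ?normsR.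
by case/eqP: ntN; apply: coprime_cent_Oup CNN.
Qed.

(** N centralises C1, and C = [C, N]; the three subgroup lemma then gives [C, C1] = 1. *)
Lemma min_noncentral_sub C1 : C1 \proper C -> X \subset 'N(C1) -> C1 \subset 'Z(C).
Proof.
move=> prC1 nC1X; have C1N := minC prC1 nC1X; have sC1C := proper_sub prC1.
rewrite subsetI sC1C centsC; apply/commG1P; rewrite -min_noncentral_comm.
apply: three_subgroup; first by rewrite [[~: N, C1]]commGC C1N comm1G.
apply/trivgP; rewrite -C1N commSg // commg_subl.
exact: subset_trans nC1X.
Qed.

Lemma min_noncentral_neq1 : C :!=: 1.
Proof. by apply: contraNneq ntN => ->; rewrite comm1G. Qed.

Lemma min_noncentral_Phi : 'Phi(C) \subset 'Z(C).
Proof.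
apply: min_noncentral_sub; first exact: Phi_proper min_noncentral_neq1.
exact: char_norm_trans (Phi_char C) nCX.
Qed.

Lemma min_noncentral_abelem W : 'Phi(C) \subset W -> C \subset 'N(W) -> p.-abelem (C / W).
Proof.
by move=> sPW nWC; rewrite -trivg_Phi ?quotient_pgroup // -(quotient_Phi pC) // quotientS1.
Qed.

End MinimalNoncentral.
End PResidual.

(** * Two by two matrices and binary quadratic forms *)

Section MatrixNotation.

Local Open Scope ring_scope.

Definition mx2 (R : pzRingType) (a b c d : R) : 'M[R]_2 :=
  \matrix_(i < 2, j < 2)
    (if i == 0 then if j == 0 then a else b else if j == 0 then c else d).

Definition rv2 (R : pzRingType) (x y : R) : 'rV[R]_2 :=
  \row_(j < 2) (if j == 0 then x else y).

End MatrixNotation.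

Section TwoByTwo.

Import GRing.Theory.
Local Open Scope ring_scope.

Variable F : fieldType.
Implicit Types (a b c d x y : F).

Lemma ord2P (i : 'I_2) : i = 0 \/ i = 1.
Proof. by case: i => -[|[]] // Hi; [left | right]; apply: val_inj. Qed.

Lemma eq_mx2 (A B : 'M[F]_2) :
  A 0 0 = B 0 0 -> A 0 1 = B 0 1 -> A 1 0 = B 1 0 -> A 1 1 = B 1 1 -> A = B.
Proof. by move=> *; apply/matrixP=> i j; case: (ord2P i) => ->; case: (ord2P j) => ->. Qed.

Lemma eq_rv2 (u v : 'rV[F]_2) : u 0 0 = v 0 0 -> u 0 1 = v 0 1 -> u = v.
Proof. by move=> *; apply/rowP=> j; case: (ord2P j) => ->. Qed.

Lemma mx2E : (forall a b c d, mx2 a b c d 0 0 = a) * (forall a b c d, mx2 a b c d 0 1 = b) *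
  (forall a b c d, mx2 a b c d 1 0 = c) * (forall a b c d, mx2 a b c d 1 1 = d).
Proof. by do ![split] => *; rewrite mxE. Qed.

Lemma rv2E : (forall x y, rv2 x y 0 0 = x) * (forall x y, rv2 x y 0 1 = y).
Proof. by do ![split] => *; rewrite mxE. Qed.

Lemma mx2_eta (A : 'M[F]_2) : A = mx2 (A 0 0) (A 0 1) (A 1 0) (A 1 1).
Proof. by apply: eq_mx2; rewrite mx2E. Qed.

Lemma rv2_eta (v : 'rV[F]_2) : v = rv2 (v 0 0) (v 0 1).
Proof. by apply: eq_rv2; rewrite rv2E. Qed.

Lemma sum2 (f : 'I_2 -> F) : \sum_(i < 2) f i = f 0 + f 1.
Proof. by rewrite big_ord_recl big_ord1; congr (_ + f _); apply: val_inj. Qed.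

Lemma mul_mx2 a b c d a' b' c' d' :
  mx2 a b c d *m mx2 a' b' c' d' =
  mx2 (a * a' + b * c') (a * b' + b * d') (c * a' + d * c') (c * b' + d * d').
Proof. by apply: eq_mx2; rewrite !mxE sum2 !mx2E. Qed.

Lemma mul_rv2 x y a b c d :
  rv2 x y *m mx2 a b c d = rv2 (x * a + y * c) (x * b + y * d).
Proof. by apply: eq_rv2; rewrite !mxE sum2 !mx2E !rv2E. Qed.

Lemma det_mx2 a b c d : \det (mx2 a b c d) = a * d - b * c.
Proof.
rewrite (expand_det_row _ 0) sum2 !mx2E /cofactor !det_mx11 !mxE /=.
by rewrite expr0 expr1 mul1r mulN1r mulrN.
Qed.

Lemma scalar_mx2 a : a%:M = mx2 a 0 0 a.
Proof. by apply: eq_mx2; rewrite !mxE. Qed.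

Lemma scale_rv2 a x y : a *: rv2 x y = rv2 (a * x) (a * y).
Proof. by apply: eq_rv2; rewrite !mxE. Qed.

Lemma rv2_inj x y x' y' : rv2 x y = rv2 x' y' -> x = x' /\ y = y'.
Proof. by move=> eq_xy; split; [rewrite -(rv2E.1 x y) | rewrite -(rv2E.2 x y)]; rewrite eq_xy rv2E. Qed.

Lemma mx2_inj a b c d a' b' c' d' :
  mx2 a b c d = mx2 a' b' c' d' -> [/\ a = a', b = b', c = c' & d = d'].
Proof. 
move=> /matrixP eqM; split; [have := eqM 0 0 | have := eqM 0 1 | have := eqM 1 0 | have := eqM 1 1].
all: by rewrite !mx2E.
Qed.

Lemma rv2_eq0 x y : (rv2 x y == 0) = (x == 0) && (y == 0).
Proof.
apply/eqP/andP => [/rowP xy0 | [/eqP-> /eqP->]].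
  by have := xy0 0; have := xy0 1; rewrite !rv2E !mxE => -> ->.
by apply: eq_rv2; rewrite !mxE.
Qed.

End TwoByTwo.

Section QuadraticForm.

Import GRing.Theory.
Local Open Scope ring_scope.

Variable F : finFieldType.

Lemma pair_eq0 (x y : F) : ((x, y) == 0) = (x == 0) && (y == 0).
Proof. by []. Qed.

Lemma card_units : #|[set a : F | a != 0]| = #|F|.-1.
Proof. by rewrite cardsE cardC1. Qed.

Lemma card_linear_zeros (s t : F) : (s != 0) || (t != 0) ->
  #|[set v : F * F | (v != 0) && (s * v.1 + t * v.2 == 0)]| = #|F|.-1.
Proof.
move=> nz; rewrite -card_units.
rewrite -(card_in_imset (f := fun a => (a * t, - (a * s)))); last first.
  move=> a b; rewrite !inE => _ _ [/eqP eq1 /eqP]; rewrite eqr_opp => eq2.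
  case/orP: nz => nz; apply: (mulIf nz); exact/eqP.
congr #|pred_of_set _|; apply/setP=> -[x y]; rewrite !inE /=.
apply/andP/imsetP => [[xy0 /eqP sxty] | [a]].
  have [t0 | tn0] := eqVneq t 0.
    have sn0 : s != 0 by move: nz; rewrite t0 eqxx orbF.
    have x0 : x = 0.
      by apply/eqP; move/eqP: sxty; rewrite t0 mul0r addr0 mulf_eq0 (negPf sn0).
    exists (- y / s); last by rewrite t0 mulr0 x0 divfK // opprK.
    by rewrite inE mulf_neq0 ?invr_eq0 // oppr_eq0; apply: contraNneq xy0 => ->; rewrite x0.
  have eq_y : y = - (x * s / t).
    have ty : t * y = - (s * x) by apply/eqP; rewrite -addr_eq0 addrC sxty.
    by apply: (mulfI tn0); rewrite ty; field.
  exists (x / t); last by rewrite divfK // eq_y mulrAC.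
  rewrite inE mulf_neq0 ?invr_eq0 //; apply: contraNneq xy0 => x0.
  by rewrite eq_y x0 !mul0r oppr0.
rewrite inE => an0 [-> ->]; split; last by apply/eqP; ring.
rewrite pair_eq0 /= oppr_eq0 !mulf_eq0 (negPf an0) /=.
by rewrite negb_and orbC.
Qed.

(** Up to the factor x0^2 the form splits into the linear form vanishing at w = (x0, y0) and a
    second one, s x + t y. The two lines of zeros coincide exactly when the second form vanishes at
    w. Its value there is x0 (s + C y0), and (s + C y0)^2 is x0^2 times the discriminant. *)
Lemma card_quadratic_zeros (A B C : F) (w : F * F) :
    (2 : F) != 0 -> [|| A != 0, B != 0 | C != 0] -> w != 0 ->
    A * w.1 ^+ 2 + B * w.1 * w.2 + C * w.2 ^+ 2 = 0 ->
  #|[set v : F * F | (v != 0) && (A * v.1 ^+ 2 + B * v.1 * v.2 + C * v.2 ^+ 2 == 0)]|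
  = ((if (B ^+ 2 - 4 * A * C == 0)%R then 1 else 2) * #|F|.-1)%N.
Proof.
move=> n2.
(* Exchanging the two coordinates exchanges A and C and preserves the discriminant. *)
wlog x0 : A B C w / w.1 != 0 => [IH|] nz.
  case: w => x0 y0 w0 /= qw.
  have [x00|] := eqVneq x0 0; last by move=> nx0; apply: (IH A B C (x0, y0)).
  have y00 : y0 != 0 by apply: contraNneq w0 => ->; rewrite x00.
  have /= IH' := IH C B A (y0, x0) y00.
  have -> : B ^+ 2 - 4 * A * C = B ^+ 2 - 4 * C * A by ring.
  rewrite -IH' //; first 1 last.
  - by case/or3P: nz => ->; rewrite ?orbT.
  - by rewrite pair_eq0 (negPf y00).
  - by rewrite -qw; ring.
  rewrite -(card_imset _ (f := fun v : F * F => (v.2, v.1))) ; last by move=> [? ?] [? ?] [-> ->].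
  apply: eq_card => -[x y]; rewrite !inE /=; apply/imsetP/idP => [[[x' y']]|/andP[v0 qv]].
    rewrite !inE /= => /andP[v0 qv] [-> ->]; rewrite !pair_eq0 /= in v0 *.
    by rewrite [X in ~~ X]andbC v0 /=; apply/eqP; rewrite -(eqP qv); ring.
  exists (y, x) => //; rewrite !inE /= !pair_eq0 /= in v0 *.
  by rewrite [X in ~~ X]andbC v0 /=; apply/eqP; rewrite -(eqP qv); ring.
case: w x0 => x0 y0 /= nx0 _ qw.
pose s := B * x0 + C * y0; pose t := C * x0.
have fact x y : x0 ^+ 2 * (A * x ^+ 2 + B * x * y + C * y ^+ 2) = (- y0 * x + x0 * y) * (s * x + t * y).
  have -> : (- y0 * x + x0 * y) * (s * x + t * y) =
     x0 ^+ 2 * (A * x ^+ 2 + B * x * y + C * y ^+ 2) -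
     (A * x0 ^+ 2 + B * x0 * y0 + C * y0 ^+ 2) * x ^+ 2 by rewrite /s /t; ring.
  by rewrite qw mul0r subr0.
have disc : x0 ^+ 2 * (B ^+ 2 - 4 * A * C) = (s + C * y0) ^+ 2.
  have -> : (s + C * y0) ^+ 2 = x0 ^+ 2 * (B ^+ 2 - 4 * A * C) + 4 * C *
     (A * x0 ^+ 2 + B * x0 * y0 + C * y0 ^+ 2) by rewrite /s; ring.
  by rewrite qw mulr0 addr0.
have x02 : x0 ^+ 2 != 0 by rewrite expf_neq0.
have st_nz : (s != 0) || (t != 0).
  rewrite -negb_and; apply: contraL nz => /andP[/eqP s0 /eqP t0].
  have C0 : C = 0 by apply/eqP; move/eqP: t0; rewrite mulf_eq0 (negPf nx0) orbF.
  have B0 : B = 0 by apply/eqP; move/eqP: s0; rewrite /s C0 mul0r addr0 mulf_eq0 (negPf nx0) orbF.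
  have A0 : A = 0 by apply/eqP; move/eqP: qw; rewrite B0 C0 !mul0r !addr0 mulf_eq0 (negPf x02) orbF.
  by rewrite A0 B0 C0 eqxx.
pose L1 := [set v : F * F | (v != 0) && (- y0 * v.1 + x0 * v.2 == 0)].
pose L2 := [set v : F * F | (v != 0) && (s * v.1 + t * v.2 == 0)].
have cL1 : #|L1| = #|F|.-1 by apply: card_linear_zeros; rewrite nx0 orbT.
have cL2 : #|L2| = #|F|.-1 by apply: card_linear_zeros.
have -> : [set v : F * F | (v != 0) && (A * v.1 ^+ 2 + B * v.1 * v.2 + C * v.2 ^+ 2 == 0)]
   = L1 :|: L2.
  apply/setP=> -[x y]; rewrite !inE /= -andb_orr; congr (_ && _).
  rewrite -mulf_eq0 -fact mulf_eq0 (negPf x02) //.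
have disc0 : (B ^+ 2 - 4 * A * C == 0) = (s + C * y0 == 0).
  by rewrite -[RHS]orbb -mulf_eq0 -expr2 -disc mulf_eq0 (negPf x02).
have inL1 v : v \in L1 -> exists2 a, a != 0 & v = (a * x0, a * y0).
  case: v => x y; rewrite inE /= => /andP[v0 /eqP vL].
  have vy : y = x / x0 * y0.
    have xy : x0 * y = y0 * x by apply/eqP; rewrite -subr_eq0 addrC -mulNr vL.
    by apply: (mulfI nx0); rewrite xy; field.
  exists (x / x0); last by rewrite divfK // vy.
  apply: contraNneq v0 => xx0; rewrite vy xx0 mul0r; move/eqP: xx0.
  by rewrite mulf_eq0 invr_eq0 (negPf nx0) orbF => /eqP->.
rewrite disc0; case: eqP => [eq0 | /eqP ne0].
  suffices ->: L2 = L1 by rewrite setUid mul1n.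
  apply/esym/eqP; rewrite eqEcard cL1 cL2 leqnn andbT; apply/subsetP=> v L1v.
  have [a an0 def_v] := inL1 v L1v; move: L1v; rewrite !inE => /andP[-> _] /=.
  rewrite def_v /= (_ : s * _ + t * _ = a * x0 * (s + C * y0)); last by rewrite /t; ring.
  by rewrite eq0 mulr0.
rewrite cardsU cL1 cL2 (_ : L1 :&: L2 = set0) ?cards0 ?subn0 ?mul2n ?addnn //.
apply/setP=> v; rewrite in_setI in_set0; apply/negP=> /andP[/inL1[a an0 ->]].
rewrite inE /= => /andP[_]; rewrite (_ : s * _ + t * _ = a * x0 * (s + C * y0)); last by rewrite /t; ring.
by rewrite !mulf_eq0 (negPf an0) (negPf nx0) (negPf ne0).
Qed.

End QuadraticForm.

(** * GL_2 acting on pairs *)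

Section PairAction.

Import GRing.Theory.
Local Open Scope ring_scope.

Variable F : finFieldType.
Definition GL2 : finGroupType := {'GL_2[F]}.
Definition mx (g : GL2) : 'M[F]_2 := GLval g.

Implicit Types (g h : GL2) (v w : F * F).

Lemma mx_inj : injective mx.
Proof. exact: val_inj. Qed.

Lemma mx1 : mx 1%g = 1%:M.
Proof. by []. Qed.

Lemma mxM g h : mx (g * h)%g = mx g *m mx h.
Proof. by []. Qed.

Lemma mx_unit g : mx g \in unitmx.
Proof. exact: (GL_unitmx g). Qed.

(* The identity matrix when a d = b c. *)
Definition mkGL (a b c d : F) : GL2 :=
  insubd (1%g : {'GL_2[F]}) (mx2 a b c d : 'M_1.+1).

Lemma mkGLE a b c d : a * d - b * c != 0 -> mx (mkGL a b c d) = mx2 a b c d.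
Proof. by move=> nz; rewrite /mx insubdK // -topredE /= unitmxE unitfE det_mx2. Qed.

Lemma GL2_det g : mx g 0 0 * mx g 1 1 - mx g 0 1 * mx g 1 0 != 0.
Proof. by rewrite -det_mx2 -mx2_eta -unitfE -unitmxE; exact: mx_unit. Qed.

Lemma mkGL_eta g : g = mkGL (mx g 0 0) (mx g 0 1) (mx g 1 0) (mx g 1 1).
Proof. by apply: mx_inj; rewrite mkGLE ?GL2_det // -mx2_eta. Qed.

Lemma GL_mul_coord g h : [/\
  mx (g * h)%g 0 0 = mx g 0 0 * mx h 0 0 + mx g 0 1 * mx h 1 0,
  mx (g * h)%g 0 1 = mx g 0 0 * mx h 0 1 + mx g 0 1 * mx h 1 1,
  mx (g * h)%g 1 0 = mx g 1 0 * mx h 0 0 + mx g 1 1 * mx h 1 0 &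
  mx (g * h)%g 1 1 = mx g 1 0 * mx h 0 1 + mx g 1 1 * mx h 1 1].
Proof. by rewrite mxM [mx g]mx2_eta [mx h]mx2_eta mul_mx2 !mx2E. Qed.

Definition pact v g : F * F :=
  (v.1 * mx g 0 0 + v.2 * mx g 1 0, v.1 * mx g 0 1 + v.2 * mx g 1 1).

Lemma pact1 : pact^~ 1%g =1 id.
Proof. by case=> x y; rewrite /pact mx1 !mxE /= !(mulr1, mulr0, addr0, add0r). Qed.

Lemma pactM v : act_morph pact v.
Proof.
by case: v => x y g h; rewrite /pact /=; have [-> -> -> ->] := GL_mul_coord g h; congr (_, _); ring.
Qed.

Canonical pair_action := TotalAction pact1 pactM.

Definition cross v w := v.1 * w.2 - v.2 * w.1.

Definition gdet g := mx g 0 0 * mx g 1 1 - mx g 0 1 * mx g 1 0.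
Definition gtr g := mx g 0 0 + mx g 1 1.

Lemma gdetE g : gdet g = \det (mx g).
Proof. by rewrite [mx g in RHS]mx2_eta det_mx2. Qed.

Lemma gtrE g : gtr g = \tr (mx g).
Proof. by rewrite /mxtrace sum2. Qed.

Lemma gdetM g h : gdet (g * h)%g = gdet g * gdet h.
Proof. by rewrite !gdetE mxM det_mulmx. Qed.

Lemma gdet_neq0 g : gdet g != 0.
Proof. exact: GL2_det. Qed.

Lemma gdetJ g h : gdet (g ^ h)%g = gdet g.
Proof.
apply: (mulfI (gdet_neq0 h)); rewrite -gdetM -conjgC gdetM; exact: mulrC.
Qed.

Lemma gtrJ g h : gtr (g ^ h)%g = gtr g.
Proof.
rewrite !gtrE /conjg mxM mxtrace_mulC -mxM -mulgA mulgV mulg1 //.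
Qed.

Lemma cross_pact v w g : cross (pact v g) (pact w g) = cross v w * gdet g.
Proof. by rewrite /cross /pact /gdet /=; ring. Qed.

(** Stated without an eigenvalue, this is a binary quadratic form in v; it holds for v = 0 as
    well. *)
Definition eigv g v := cross v (pact v g) == 0.

Lemma eigvJ g h v : eigv (g ^ h)%g (pact v h) = eigv g v.
Proof.
rewrite /eigv -pactM -conjgC pactM cross_pact mulf_eq0 (negPf (gdet_neq0 h)).
by rewrite orbF.
Qed.

Lemma pact0 g : pact 0 g = 0.
Proof. by rewrite /pact /= !mul0r !addr0. Qed.

Lemma pact_eq0 v g : (pact v g == 0) = (v == 0).
Proof. by rewrite -{1}(pact0 g); apply: (inj_eq (act_inj pair_action g) v 0). Qed.

Definition sc (a : F) v : F * F := (a * v.1, a * v.2).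

Lemma sc_eq0 a v : (sc a v == 0) = (a == 0) || (v == 0).
Proof. by case: v => x y; rewrite /sc !pair_eq0 !mulf_eq0 /= -orb_andr. Qed.

Lemma cross_eq0 v w : v != 0 -> cross v w = 0 -> exists a, w = sc a v.
Proof.
case: v w => [x y] [x' y']; rewrite pair_eq0 negb_and /cross /= => nz /eqP.
rewrite subr_eq0 => /eqP eqc; case: (eqVneq x 0) nz eqc => [-> | nx _ eqc] /=.
  move=> ny; rewrite mul0r => /esym/eqP; rewrite mulf_eq0 (negPf ny) /= => /eqP ->.
  by exists (y' / y); rewrite /sc /= mulr0 divfK.
exists (x' / x); rewrite /sc /= divfK //; congr (_, _).
by apply: (mulfI nx); rewrite eqc; field.
Qed.

Lemma eigvP g v : v != 0 -> reflect (exists2 a, a != 0 & pact v g = sc a v) (eigv g v).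
Proof.
move=> nz; apply: (iffP eqP) => [/(cross_eq0 nz)[a eqa] | [a _ ->]]; last first.
  by rewrite /cross /sc /=; ring.
by exists a => //; have := pact_eq0 v g; rewrite eqa sc_eq0 (negPf nz) orbF => ->.
Qed.

Definition scal (a : F) := mkGL a 0 0 a.

Lemma scalE a : a != 0 -> mx (scal a) = mx2 a 0 0 a.
Proof. by move=> nz; rewrite mkGLE // mulr0 subr0 mulf_neq0. Qed.

Lemma pact_scal v a : a != 0 -> pact v (scal a) = sc a v.
Proof. by move=> nz; rewrite /pact scalE // !mx2E /sc; congr (_, _); ring. Qed.

Definition scalars := [set scal a | a in [set a : F | a != 0]].

Lemma scalarsP g : reflect (exists2 a, a != 0 & g = scal a) (g \in scalars).
Proof. by apply: (iffP imsetP) => -[a nz ->]; exists a => //; move: nz; rewrite inE. Qed.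

Lemma scalM a b : a != 0 -> b != 0 -> (scal a * scal b)%g = scal (a * b).
Proof.
move=> na nb; apply: mx_inj; rewrite [LHS]mxM [RHS]scalE ?mulf_neq0 // !scalE // mul_mx2.
by apply: eq_mx2; rewrite !mx2E; ring.
Qed.

Lemma scalars_group_set : group_set scalars.
Proof.
apply/group_setP; split=> [|g h /scalarsP[a na ->] /scalarsP[b nb ->]].
  apply/scalarsP; exists 1; rewrite ?oner_neq0 //; apply: mx_inj.
  by rewrite [RHS]scalE ?oner_neq0 //; apply: eq_mx2; rewrite !mx2E !mxE.
by apply/scalarsP; exists (a * b); rewrite ?mulf_neq0 // scalM.
Qed.
Canonical scalars_group := Group scalars_group_set.

Lemma card_scalars : #|scalars| = #|F|.-1.
Proof.
rewrite card_in_imset ?card_units // => a b; rewrite !inE => na nb eqs.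
by have := congr1 (fun g => mx g 0 0) eqs; rewrite /= !scalE // !mx2E.
Qed.

Lemma mem_scalars g : (g \in scalars) = [&& mx g 0 1 == 0, mx g 1 0 == 0 & mx g 0 0 == mx g 1 1].
Proof.
apply/scalarsP/and3P => [[a na ->] | [/eqP b0 /eqP c0 /eqP ad]]; first by rewrite scalE // !mx2E.
exists (mx g 0 0); last by rewrite {1}[g]mkGL_eta b0 c0 -ad.
by have := GL2_det g; rewrite b0 mul0r subr0 -ad; apply: contraNneq => ->; rewrite mul0r.
Qed.

Lemma card_pairs_neq0 : #|[set v : F * F | v != 0]| = (#|F|.-1 * #|F|.+1)%N.
Proof.
rewrite cardsE cardC1 card_prod.
have : (0 < #|F|)%N by apply/card_gt0P; exists 0.
by case: #|F| => // k _; lia.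
Qed.

Definition disc g := (mx g 1 1 - mx g 0 0) ^+ 2 + 4 * mx g 0 1 * mx g 1 0.

Lemma discE g : disc g = gtr g ^+ 2 - 4 * gdet g.
Proof. by rewrite /disc /gtr /gdet; ring. Qed.

Lemma discJ g h : disc (g ^ h)%g = disc g.
Proof. by rewrite !discE gtrJ gdetJ. Qed.

(** In odd characteristic these are the scalar multiples of nontrivial unipotent elements. *)
Definition uni g := (g \notin scalars) && (disc g == 0).

Lemma eigv_scalar g v : g \in scalars -> eigv g v.
Proof. by case/scalarsP=> a na ->; rewrite /eigv pact_scal // /cross /sc /=; apply/eqP; ring. Qed.

(** The form v |-> [cross v (pact v g)] has discriminant [disc g] and vanishes identically only for
    scalar g. The summand with [uni g] makes up for the second eigenline when there is only one, so
    that both cases read alike. *)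
Lemma card_eigv g : (2 : F) != 0 -> g \notin scalars -> (exists2 v : F * F, v != 0 & eigv g v) ->
  (#|[set v : F * F | (v != 0)%R && eigv g v]| + uni g * #|F|.-1 = 2 * #|F|.-1)%N.
Proof.
move=> n2 nSc [w nw /eqP ew].
pose A : F := mx g 0 1; pose B := mx g 1 1 - mx g 0 0; pose C := - mx g 1 0.
have qE v : cross v (pact v g) = A * v.1 ^+ 2 + B * v.1 * v.2 + C * v.2 ^+ 2.
  by rewrite /cross /pact /A /B /C /=; ring.
have -> : [set v : F * F | (v != 0) && eigv g v] =
  [set v : F * F | (v != 0) && (A * v.1 ^+ 2 + B * v.1 * v.2 + C * v.2 ^+ 2 == 0)].
  by apply/setP=> v; rewrite !inE /eigv qE.
rewrite (@card_quadratic_zeros F A B C w) // -?qE //; last first.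
  move: nSc; rewrite mem_scalars -!negb_and; apply: contra => /and3P[A0 B0 C0].
  by apply/and3P; split; [| rewrite -oppr_eq0 | rewrite eq_sym -subr_eq0].
rewrite /uni nSc /= (_ : disc g = B ^+ 2 - 4 * A * C); last by rewrite /disc /A /B /C; ring.
by case: (_ == 0) => /=; lia.
Qed.

End PairAction.

(** * Unipotent elements and transvections in characteristic p *)

Section Unipotent.

Import GRing.Theory.
Local Open Scope ring_scope.

Variables (F : finFieldType) (p : nat).
Hypotheses (p_pr : prime p) (p_gt2 : (2 < p)%N) (chF : p \in [pchar F]).
Implicit Types (g h : GL2 F) (v w : F * F).

Lemma char_odd_neq0 : (2 : F) != 0.
Proof.
rewrite -(dvdn_pcharf chF); apply: contraL p_gt2 => /dvdn_leq; rewrite -leqNgt; exact.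
Qed.

(** By Cayley-Hamilton (g - 1)^2 = 0, so g^k = 1 + k (g - 1). *)
Lemma unipotent_exp g k : gtr g = 2 -> gdet g = 1 ->
  [/\ mx (g ^+ k)%g 0 0 = 1 + k%:R * (mx g 0 0 - 1), mx (g ^+ k)%g 0 1 = k%:R * mx g 0 1,
      mx (g ^+ k)%g 1 0 = k%:R * mx g 1 0 & mx (g ^+ k)%g 1 1 = 1 + k%:R * (mx g 1 1 - 1)].
Proof.
rewrite /gtr /gdet; set a := mx g 0 0; set b := mx g 0 1.
set c := mx g 1 0; set d := mx g 1 1 => tr2 det1.
have dE : d = 2 - a by rewrite -tr2; ring.
have bcE : b * c = - (a - 1) ^+ 2 by rewrite -[b * c]opprK -[- (b * c)](addKr (a * d)) det1 dE; ring.
elim: k => [|k [e1 e2 e3 e4]].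
  by rewrite expg0 mx1 !mxE /= !mul0r !addr0.
rewrite expgSr; have [-> -> -> ->] := GL_mul_coord (g ^+ k)%g g.
rewrite e1 e2 e3 e4 -/a -/b -/c -/d -natr1; split.
- by rewrite -[k%:R * b * c]mulrA bcE; ring.
- by rewrite dE; ring.
- by rewrite dE; ring.
by rewrite -[k%:R * c * b]mulrA [c * b]mulrC bcE dE; ring.
Qed.

Lemma GL2_eq1 g : mx g 0 0 = 1 -> mx g 0 1 = 0 -> mx g 1 0 = 0 -> mx g 1 1 = 1 ->
  g = 1%g.
Proof.
by move=> *; apply: mx_inj; rewrite [RHS]mx1; apply: eq_mx2; rewrite !mxE.
Qed.

Lemma unipotent_exp_p g : gtr g = 2 -> gdet g = 1 -> (g ^+ p = 1)%g.
Proof.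
move=> tr2 det1; have [e1 e2 e3 e4] := unipotent_exp p tr2 det1.
by apply: GL2_eq1; rewrite ?e1 ?e2 ?e3 ?e4 (pcharf0 chF) !mul0r ?addr0.
Qed.

Lemma pact_fix2 g v w : cross v w != 0 -> pact v g = v -> pact w g = w -> g = 1%g.
Proof.
case: v w => [x y] [s t] ncr [e1 e2] [e3 e4].
have cancel z : cross (x, y) (s, t) * z = 0 -> z = 0.
  by move/eqP; rewrite mulf_eq0 (negPf ncr) => /eqP.
have {}e1 : x * (mx g 0 0 - 1) + y * mx g 1 0 = 0 by rewrite -[RHS](subrr x) -{2}e1 /=; ring.
have {}e2 : x * mx g 0 1 + y * (mx g 1 1 - 1) = 0 by rewrite -[RHS](subrr y) -{2}e2 /=; ring.
have {}e3 : s * (mx g 0 0 - 1) + t * mx g 1 0 = 0 by rewrite -[RHS](subrr s) -{2}e3 /=; ring.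
have {}e4 : s * mx g 0 1 + t * (mx g 1 1 - 1) = 0 by rewrite -[RHS](subrr t) -{2}e4 /=; ring.
(* Cramer's rule for the four entries of g - 1. *)
apply: GL2_eq1; try (apply/eqP; rewrite -subr_eq0; apply/eqP); apply: cancel; rewrite /cross /=.
- rewrite (_ : _ * _ = t * (x * (mx g 0 0 - 1) + y * mx g 1 0) - y * (s * (mx g 0 0 - 1) + t * mx g 1 0)); last by ring.
  by rewrite e1 e3 !mulr0 subrr.
- rewrite (_ : _ * _ = t * (x * mx g 0 1 + y * (mx g 1 1 - 1)) - y * (s * mx g 0 1 + t * (mx g 1 1 - 1))); last by ring.
  by rewrite e2 e4 !mulr0 subrr.
- rewrite (_ : _ * _ = x * (s * (mx g 0 0 - 1) + t * mx g 1 0) - s * (x * (mx g 0 0 - 1) + y * mx g 1 0)); last by ring.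
  by rewrite e1 e3 !mulr0 subrr.
rewrite (_ : _ * _ = x * (s * mx g 0 1 + t * (mx g 1 1 - 1)) - s * (x * mx g 0 1 + y * (mx g 1 1 - 1))); last by ring.
by rewrite e2 e4 !mulr0 subrr.
Qed.

Lemma mem_scalarsJ g h : ((g ^ h)%g \in scalars F) = (g \in scalars F).
Proof.
have ScC a k : a != 0 -> (scal a * k = k * scal a :> GL2 F)%g.
  move=> na; apply: mx_inj; rewrite !mxM scalE //; rewrite [mx k]mx2_eta !mul_mx2.
  by apply: eq_mx2; rewrite !mx2E; ring.
apply/scalarsP/scalarsP => -[a na ea]; exists a => //.
  by rewrite -(conjgK h g) ea conjgE invgK ScC // mulKVg.
by rewrite ea conjgE ScC // mulKg.
Qed.

Lemma dvdn_card_char : (p %| #|F|)%N.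
Proof.
rewrite [#|_|](card_pprimeChar chF); case: logn (card_pprimeChar chF) (finRing_gt1 F) => [|k _ _].
  by rewrite expn0 => ->.
by rewrite expnS dvdn_mulr.
Qed.

Definition Utr (b : F) := mkGL 1 b 0 1.

Lemma UtrE b : mx (Utr b) = mx2 1 b 0 1.
Proof. by rewrite mkGLE // mulr0 subr0 mulr1 oner_neq0. Qed.

Lemma UtrM a b : (Utr a * Utr b)%g = Utr (a + b).
Proof.
by apply: mx_inj; rewrite [LHS]mxM [RHS]UtrE !UtrE mul_mx2; apply: eq_mx2; rewrite !mx2E; ring.
Qed.

Lemma Utr_inj : injective Utr.
Proof. by move=> a b eqU; have := congr1 (fun g => mx g 0 1) eqU; rewrite /= !UtrE !mx2E. Qed.

Lemma Utr_tr b : gtr (Utr b) = 2. Proof. by rewrite /gtr UtrE !mx2E; ring. Qed.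
Lemma Utr_det b : gdet (Utr b) = 1. Proof. by rewrite /gdet UtrE !mx2E; ring. Qed.

Lemma Utr0 : Utr 0 = 1%g.
Proof. by apply: GL2_eq1; rewrite UtrE !mx2E. Qed.

Lemma UtrX b k : (Utr b ^+ k)%g = Utr (b * k%:R).
Proof.
elim: k => [|k IHk]; first by rewrite mulr0 Utr0 expg0.
by rewrite expgSr IHk UtrM -natr1; congr Utr; ring.
Qed.

Lemma pact_Utr v b : pact v (Utr b) = (v.1, v.1 * b + v.2).
Proof. by rewrite /pact UtrE !mx2E; congr (_, _); ring. Qed.

End Unipotent.

(** * Stabilisers and unipotent elements in a group containing the scalars and a transvection *)

Section UnipotentCount.

Import GRing.Theory.
Local Open Scope ring_scope.

Variables (F : finFieldType) (p : nat) (G : {group (GL2 F)}).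
Hypotheses (p_pr : prime p) (p_gt2 : (2 < p)%N) (chF : p \in [pchar F]).
Hypotheses (sScG : scalars F \subset G) (uG : Utr (1 : F) \in G).
Implicit Types (g h : GL2 F) (v w : F * F).

Local Notation f := (#|F|.-1).
Local Notation act := (pair_action F).
Local Notation st v := ('C_G[v | act])%g.

(** The row spanning the common fixed line of all [Utr b]. *)
Definition row01 : F * F := (0, 1).
Local Notation e2 := row01.

Definition row01_orbit := orbit act G e2.
Local Notation Om := row01_orbit.

Definition Utr_entries := [set b | Utr b \in G].
Local Notation B := Utr_entries.

Lemma inGM g h : g \in G -> h \in G -> (g * h)%g \in G.
Proof. exact: groupM. Qed.

Lemma inGV g : g \in G -> (g^-1)%g \in G.
Proof. by move=> Gg; rewrite groupV. Qed.

Lemma inGX g k : g \in G -> (g ^+ k)%g \in G.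
Proof. exact: groupX. Qed.

Lemma mem_B b : (b \in B) = (Utr b \in G).
Proof. by rewrite in_set. Qed.

Lemma B0 : 0 \in B. Proof. by rewrite mem_B Utr0 group1. Qed.
Lemma B1 : 1 \in B. Proof. by rewrite mem_B. Qed.
Lemma BD : {in B &, forall a b, a + b \in B}.
Proof. by move=> a b; rewrite !mem_B -UtrM; apply: inGM. Qed.
Lemma BMn a k : a \in B -> a * k%:R \in B.
Proof. by rewrite !mem_B -UtrX; apply: inGX. Qed.

Lemma BN a : a \in B -> - a \in B.
Proof.
move=> Ba; have := BMn p.-1 Ba; congr (_ \in B); apply/eqP; rewrite -subr_eq0 opprK.
by rewrite -[X in _ + X]mulr1 -mulrDr natr1 prednK ?prime_gt0 // (pcharf0 chF) mulr0.
Qed.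

Definition Utr_set := [set Utr b | b in B].

Lemma Utr_group_set : group_set Utr_set.
Proof.
apply/group_setP; split=> [|_ _ /imsetP[a Ba ->] /imsetP[b Bb ->]].
  by rewrite -(Utr0 F) imset_f ?B0.
by rewrite UtrM imset_f ?BD.
Qed.
Canonical Utr_group := Group Utr_group_set.

Lemma card_Utr_set : #|Utr_set| = #|B|.
Proof. by rewrite card_imset //; apply: Utr_inj. Qed.

Lemma Utr_set_sub : Utr_set \subset G.
Proof. by apply/subsetP=> _ /imsetP[b /[!mem_B] ? ->]. Qed.

Lemma Utr_pgroup : (p.-group Utr_set)%g.
Proof.
rewrite -pnat_exponent (pnat_dvd _ (pnat_id p_pr)) //; apply/exponentP=> _ /imsetP[b _ ->].
by apply: unipotent_exp_p => //; rewrite ?Utr_tr ?Utr_det.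
Qed.

Lemma stP v g : reflect (g \in G /\ pact v g = v) (g \in st v).
Proof. by rewrite in_setI; apply: (iffP andP) => -[Gg /astab1P]. Qed.

Lemma scal_in a : a != 0 -> scal a \in G.
Proof. by move=> na; apply: (subsetP sScG); apply/scalarsP; exists a. Qed.

Lemma sc_id a v : v != 0 -> sc a v = v -> a = 1.
Proof.
case: v => x y; rewrite pair_eq0 negb_and => nz [ex ey].
by case/orP: nz => nz; apply: (mulIf nz); rewrite mul1r.
Qed.

(** Dividing by the eigenvalue at v writes the stabiliser of a line as the product of [st v] and the
    scalars, which meet trivially. *)
Lemma line_stab_card v : v != 0 -> #|[set g in G | eigv g v]| = (#|st v| * f)%N.
Proof.
move=> nv; rewrite -card_scalars -TI_cardMg; last first.
  apply/trivgP/subsetP=> g /setIP[/stP[_ eqv] /scalarsP[a na def_g]].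
  have -> : g = scal 1 by move: eqv; rewrite def_g pact_scal // => /(sc_id nv) ->.
  by rewrite inE -[scal 1]/(Utr 0) Utr0.
congr #|pred_of_set _|; apply/setP=> g; rewrite inE; apply/andP/mulsgP.
  case=> Gg /(eigvP _ nv)[a na ea].
  exists (g * (scal a)^-1)%g (scal a); last by rewrite mulgKV.
    apply/stP; split; first by apply: inGM => //; apply/inGV/scal_in.
    by rewrite pactM ea -pact_scal // -pactM mulgV pact1.
  by apply/scalarsP; exists a.
case=> h s /stP[Gh eh] /scalarsP[a na ->] ->; split; first by apply: inGM => //; apply: scal_in.
by apply/(eigvP _ nv); exists a => //; rewrite pactM eh pact_scal.
Qed.

Lemma Om_stable g v : g \in G -> (pact v g \in Om) = (v \in Om).
Proof.
move=> Gg; apply/idP/idP => /orbitP[h Gh /= eh]; apply/orbitP; last first.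
  by exists (h * g)%g; [apply: inGM | rewrite /= pactM eh].
exists (h * g^-1)%g; first by apply/inGM/inGV.
by rewrite /= pactM eh -pactM mulgV pact1.
Qed.

Lemma Om_sc a v : a != 0 -> (sc a v \in Om) = (v \in Om).
Proof. by move=> na; rewrite -pact_scal // Om_stable ?scal_in. Qed.

Lemma e2_neq0 : e2 != 0.
Proof. by rewrite pair_eq0 oner_eq0 andbF. Qed.

Lemma Om_e2 : e2 \in Om. Proof. exact: orbit_refl. Qed.

Lemma Om_neq0 v : v \in Om -> v != 0.
Proof. by case/orbitP=> g _ <-; rewrite pact_eq0 e2_neq0. Qed.

Lemma Om_orbit v : v \in Om -> exists2 g, g \in G & v = pact e2 g.
Proof. by case/orbitP=> g Gg <-; exists g. Qed.

Lemma OmP g : g \in G -> pact e2 g \in Om.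
Proof. by move=> Gg; apply/orbitP; exists g. Qed.

(** Let R be a Sylow p-subgroup containing all the [Utr b] of G. It fixes a nonzero row, which is
    fixed by [Utr 1] and so spans the line of [row01]. Since g has order p, it is conjugate in G
    into R, and its fixed line is a translate of that line. *)
Lemma unipotent_fix_Om g v :
  g \in G -> g != 1%g -> gtr g = 2 -> gdet g = 1 -> v != 0 -> pact v g = v -> v \in Om.
Proof.
move=> Gg ng tr2 det1 nv fixv.
have [R sylR sPR] := Sylow_superset Utr_set_sub Utr_pgroup.
have [sRG pR _] := and3P sylR.
pose V := [set w : F * F | w != 0].
have actsR : [acts R, on V | act]%g.
  apply/actsP=> h _ w; by rewrite !inE /= pact_eq0.
(* The number of nonzero vectors is |F|^2 - 1, which is prime to p. *)
have [w nw fixw] : exists2 w, w != 0 & forall h, h \in R -> pact w h = w.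
  have : #|'Fix_(V | act)(R)|%g != 0.
    apply/eqP=> F0; have := pgroup_fix_mod pR actsR; rewrite F0 mod0n.
    move/eqP; rewrite -/(dvdn _ _) => pV; have := dvdn_mulr #|F| (dvdn_card_char chF).
    rewrite -card_prod (cardD1 (0 : F * F)) (@eq_card _ _ (mem V)) ?dvdn_addl //.
      by rewrite dvdn1 => /eqP p1; have := prime_gt1 p_pr; rewrite p1.
    by move=> w; rewrite !inE andbT.
  rewrite -lt0n => /card_gt0P[w /setIP[]]; rewrite inE => nw /afixP fixw.
  by exists w => // h Rh; apply: fixw.
have w1 : w.1 = 0.
  have := fixw (Utr 1) (subsetP sPR _ (imset_f _ B1)); rewrite pact_Utr mulr1.
  by move/(congr1 snd) => /= /eqP; rewrite -subr_eq0 addrK => /eqP.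
have w_Om : w \in Om.
  have -> : w = sc w.2 e2 by case: w w1 {nw fixw} => x y /= ->; rewrite /sc mulr0 mulr1.
  rewrite Om_sc ?Om_e2 //; apply: contraNneq nw => w2.
  by rewrite [w]surjective_pairing w1 w2.
have pg : (p.-group <[g]>)%g.
  by rewrite /pgroup (pnat_dvd _ (pnat_id p_pr)) // order_dvdn unipotent_exp_p.
have [|h Gh sgR] := Sylow_subJ sylR _ pg; first by rewrite cycle_subG.
have fixg : pact (pact w h) g = pact w h.
  have : g \in (R :^ h)%g by rewrite -cycle_subG.
  case/imsetP=> r Rr ->; rewrite -pactM -conjgC pactM; congr (pact _ h); exact: fixw.
have wh_Om : pact w h \in Om by rewrite Om_stable.
have nwh := Om_neq0 wh_Om.
suffices /(cross_eq0 nwh)[a def_v] : cross (pact w h) v = 0.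
  rewrite def_v Om_sc //; by apply: contraNneq nv => a0; rewrite def_v sc_eq0 a0 eqxx.
apply/eqP/idPn => ncr; case/eqP: ng.
by apply: pact_fix2 ncr fixg fixv.
Qed.

Definition dirs := [set mx g 0 0 | g in st e2].

Lemma st_e2P g : reflect [/\ g \in G, mx g 1 0 = 0 & mx g 1 1 = 1] (g \in st e2).
Proof.
apply: (iffP (stP _ _)) => [[Gg eg] | [Gg c0 d1]].
  have := congr1 fst eg; have := congr1 snd eg.
  by rewrite /pact /= !mul0r !mul1r !add0r.
by split=> //; rewrite /pact c0 d1 /= !mul0r !mul1r !add0r.
Qed.

(** Conjugating [Utr 1] by an element of the stabiliser with top left entry a gives [Utr a]. *)
Lemma dirs_B a : a \in dirs -> a != 0 /\ a \in B.
Proof.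
case/imsetP=> g /st_e2P[Gg c0 d1] ->; set x := mx g 0 0; set y := mx g 0 1.
have eg : g = mkGL x y 0 1 by rewrite [g]mkGL_eta c0 d1.
have nx : x != 0 by have := GL2_det g; rewrite c0 d1 mulr1 mulr0 subr0.
split=> //; have := inGM (inGM Gg uG) (inGV Gg); rewrite mem_B; congr (_ \in G).
apply: (canLR (mulgK _)); apply: mx_inj; rewrite !mxM UtrE UtrE eg mkGLE ?mulr1 ?mulr0 ?subr0 //.
by rewrite !mul_mx2; apply: eq_mx2; rewrite !mx2E; ring.
Qed.

Lemma card_dirs : (#|dirs| < #|B|)%N.
Proof.
rewrite (cardsD1 0 B) B0 ltnS subset_leq_card //; apply/subsetP=> a /dirs_B[na Ba].
by rewrite !inE na -mem_B.
Qed.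

(** The fibres of the top left entry on the stabiliser are cosets of the group of the [Utr b] in
    G. *)
Lemma card_st_e2 : #|st e2| = (#|dirs| * #|B|)%N.
Proof.
rewrite -sum1_card (partition_big_imset (fun g => mx g 0 0)) /= -sum_nat_const.
apply: eq_bigr => _ /imsetP[g0 stg0 ->]; rewrite sum1dep_card.
have /st_e2P[Gg0 c0 d1] := stg0; rewrite -[RHS](card_imset _ (f := fun b => (Utr b * g0)%g)); last first.
  by move=> a b /mulIg/Utr_inj.
congr #|pred_of_set _|; apply/setP=> g; rewrite in_set; apply/andP/imsetP.
  case=> /st_e2P[Gg c d] /eqP ea; exists (mx g 0 1 - mx g0 0 1).
    rewrite mem_B; have := inGM Gg (inGV Gg0); congr (_ \in G).
    apply: (canLR (mulgK _)); apply: mx_inj; rewrite mxM UtrE [mx g0]mx2_eta c0 d1 -ea mul_mx2.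
    by rewrite [mx g in LHS]mx2_eta c d; apply: eq_mx2; rewrite !mx2E; ring.
  apply: mx_inj; rewrite mxM UtrE [mx g0]mx2_eta c0 d1 -ea mul_mx2 !mx2E.
  by rewrite [mx g in LHS]mx2_eta c d; apply: eq_mx2; rewrite !mx2E; ring.
case=> b; rewrite mem_B => Bb ->; split.
  apply/st_e2P; split; first exact: inGM.
    by rewrite mxM UtrE [mx g0]mx2_eta c0 d1 mul_mx2 !mx2E; ring.
  by rewrite mxM UtrE [mx g0]mx2_eta c0 d1 mul_mx2 !mx2E; ring.
by apply/eqP; rewrite mxM UtrE [mx g0]mx2_eta c0 d1 mul_mx2 !mx2E; ring.
Qed.

Lemma double_count (I J : finType) (X : {set I}) (Y : {set J}) (R : I -> J -> bool) :
  (\sum_(i in X) #|[set j in Y | R i j]| = \sum_(j in Y) #|[set i in X | R i j]|)%N.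
Proof.
under eq_bigr do rewrite -sum1dep_card.
under [RHS]eq_bigr do rewrite -sum1dep_card.
rewrite (exchange_big_dep (mem Y)) /=; last by move=> i j _ /andP[].
by apply: eq_bigr => j Yj; apply: eq_bigl => i; rewrite Yj.
Qed.

(** The elements in question are the products of a nonzero scalar and a [Utr b] with b nonzero in
    B. *)
Lemma card_uni_e2 : #|[set g in G | uni g && eigv g e2]| = (f * #|B|.-1)%N.
Proof.
have -> : #|B|.-1 = #|B :\ 0| by rewrite (cardsD1 0 B) B0.
rewrite -card_units -cardsX.
rewrite -(card_in_imset (f := fun ab : F * F => (scal ab.1 * Utr ab.2)%g)); last first.
  move=> [a b] [a' b']; rewrite !in_setX !in_set /= => /andP[na _] /andP[na' _] /(congr1 (@mx F)).
  rewrite !mxM !scalE // !UtrE !mul_mx2 => /mx2_inj[]; rewrite !(mulr0, addr0, mulr1) => -> /(mulfI na') -> //.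
congr #|pred_of_set _|; apply/setP=> g; rewrite in_set; apply/idP/imsetP.
  case/and3P=> Gg /andP[nSc /eqP d0] ev.
  have c0 : mx g 1 0 = 0.
    by move: ev; rewrite /eigv /cross /pact /= !mul0r !mul1r !add0r oppr_eq0 => /eqP.
  have da : mx g 1 1 = mx g 0 0.
    move/eqP: d0; rewrite /disc c0 mulr0 addr0 expf_eq0 /= subr_eq0.
    by move/eqP.
  have na : mx g 0 0 != 0.
    by have := GL2_det g; rewrite c0 mulr0 subr0 da mulf_eq0 orbb.
  have eg : g = (scal (mx g 0 0)%R * Utr (mx g 0 1 / mx g 0 0)%R)%g.
    apply: mx_inj; rewrite mxM scalE // UtrE mul_mx2 [mx g in LHS]mx2_eta c0 da.
    by apply: eq_mx2; rewrite !mx2E; field.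
  exists (mx g 0 0, mx g 0 1 / mx g 0 0) => //; rewrite in_setX in_set /= na /=.
  rewrite in_setD1 mem_B mulf_neq0 ?invr_eq0 //=; last first.
    by apply: contra nSc => b0; rewrite mem_scalars b0 c0 da !eqxx.
  by rewrite -(mulKg (scal (mx g 0 0)) (Utr _)) -eg; apply/inGM => //; apply/inGV/scal_in.
case=> -[a b]; rewrite in_setX in_setD1 [a \in _]in_set /= mem_B => /and3P[na nb Bb] ->.
have -> : (scal a * Utr b)%g \in G by apply: inGM => //; apply: scal_in.
rewrite /uni mem_scalars /eigv /disc mxM scalE // UtrE mul_mx2 !mx2E.
rewrite !(mulr0, addr0, mulr1, mul0r, add0r) /= mulf_eq0 (negPf na) (negPf nb) subrr expr0n eqxx /=.
by rewrite eqxx /cross /pact mxM scalE // UtrE mul_mx2 !mx2E; apply/eqP; rewrite /=; ring.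
Qed.

Lemma card_uni_Om v : v \in Om ->
  #|[set g in G | uni g && eigv g v]| = (f * #|B|.-1)%N.
Proof.
case/Om_orbit=> h Gh ->; rewrite -card_uni_e2.
rewrite -[RHS](card_imset _ (@conjg_inj _ h)); congr #|pred_of_set _|.
apply/setP=> g; rewrite in_set; apply/idP/imsetP => [/and3P[Gg ug eg] | [k]].
  exists (g ^ h^-1)%g; last by rewrite conjgKV.
  rewrite in_set -(eigvJ _ h) conjgKV eg andbT /uni discJ.
  have -> : (g ^ h^-1 \in G)%g by apply/inGM; [rewrite invgK | apply/inGM => //; apply/inGV].
  case/andP: ug => nSc ->; rewrite andbT /=; apply: contra nSc => Scg.
  by rewrite -(conjgKV h g) mem_scalarsJ.
rewrite in_set => /and3P[Gk /andP[nSc d0] ek] ->.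
rewrite eigvJ ek /uni discJ d0 !andbT mem_scalarsJ nSc andbT.
by apply/inGM; [apply/inGV | apply/inGM].
Qed.

End UnipotentCount.

(** * Orbit counting for a group of matrices that all have an eigenvector *)

Section Arithmetic.
Local Open Scope nat_scope.

(** In these three lemmas f = |F| - 1, n is the number of lines in the orbit of [row01], q = |B|, d
    = [#|dirs G|] and g = |G|. W is the sum of the stabiliser orders over the nonzero vectors
    outside that orbit, and D is the number of such vectors. The hypotheses give W - D = g - f (n (q
    - 2) + 2), while an orbit of length o contributes g - o to W - D. The lemmas treat zero, one and
    at least two outer orbits with nontrivial stabilisers. In the last case each of two orbits
    contributes at least g / 2, although W - D < g. *)
Lemma orbit_arith0 f n q d W g : 2 < q ->
  W + f * n * q.-1 = f * f + g -> W + f * n = f * f.+2 -> g = f * n * (d * q) ->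
  f * (n * (q - 2) + 2) = f * (n * q * d).
Proof. by case: q => [|[|r]] //= _; rewrite !subSS subn0; lia. Qed.

Lemma orbit_arith1 f n q W g D X o : 2 < q ->
  W + f * n * q.-1 = f * f + g -> D + f * n = f * f.+2 ->
  g + X = W -> X + o = D -> o = f * (n * (q - 2) + 2).
Proof. by case: q => [|[|r]] //= _; rewrite !subSS subn0; lia. Qed.

Lemma orbit_arith2 f n q W g D o0 o1 X0 X1 Y0 Y1 : 0 < f -> 2 < q ->
  W + f * n * q.-1 = f * f + g -> D + f * n = f * f.+2 ->
  g + X0 = W -> g + X1 = X0 -> Y1 <= X1 -> Y1 + o1 = Y0 -> Y0 + o0 = D ->
  2 * o0 <= g -> 2 * o1 <= g -> False.
Proof. by move=> f0; case: q => [|[|r]] //= _; lia. Qed.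

(** With k q slopes there are n = k q + 1 lines. After cancelling q the divisor is c = 1 + k (q -
    2), and n d = d c + 2 k d. As c is prime to k it divides 2 d, and d < q bounds k by 3. For k = 2
    the number c = 2 q - 3 is odd, so it divides d, which is too small. *)
Lemma slopes_arith (q k d : nat) : (2 < q)%N -> odd q -> (0 < k)%N -> (0 < d)%N -> (d < q)%N ->
  ((k * q).+1 * (q - 2) + 2 %| (k * q).+1 * q * d)%N ->
  k = 1%N \/ [/\ q = 3, k = 3 & d = 2]%N.
Proof.
move=> q2 oq k0 d0 dq.
pose c := (1 + k * (q - 2))%N.
have -> : ((k * q).+1 * (q - 2) + 2 = q * c)%N.
  by rewrite /c; case: (q) q2 => [|[|r]] // _; rewrite !subSS subn0; lia.
have -> : ((k * q).+1 * q * d = q * ((k * q).+1 * d))%N by lia.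
rewrite dvdn_pmul2l ?(ltn_trans _ q2) //.
have -> : ((k * q).+1 * d = d * c + k * (2 * d))%N.
  by rewrite /c; case: (q) q2 => [|[|r]] // _; rewrite !subSS subn0; lia.
have cop : coprime c k.
  by rewrite /coprime -gcdn_modl /c addnC [(k * _)%N]mulnC modnMDl gcdn_modl gcd1n.
rewrite (dvdn_addr _ (dvdn_mull d (dvdnn c))) (Gauss_dvdr _ cop).
move=> cd; have c_le : (c <= 2 * d)%N by rewrite dvdn_leq // muln_gt0.
have [k1|k1] := leqP k 1; [left; lia | right].
have k3 : (k <= 3)%N by rewrite /c in c_le; nia.
have : (k == 2) || (k == 3) by lia.
case/orP=> /eqP ek; last first.
  have q3 : q = 3 by rewrite /c ek in c_le; lia.
  by split=> //; rewrite /c ek q3 in c_le; lia.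
have : (c %| d)%N.
  by move: cd; rewrite Gauss_dvdr // coprimen2 /c ek; lia.
by move/dvdn_leq => /(_ d0); rewrite /c ek; lia.
Qed.

End Arithmetic.

Section OrbitCount.

Import GRing.Theory.
Local Open Scope ring_scope.

Variables (F : finFieldType) (p : nat) (G : {group (GL2 F)}).
Hypotheses (p_pr : prime p) (p_gt2 : (2 < p)%N) (chF : p \in [pchar F]).
Hypotheses (sScG : scalars F \subset G) (uG : Utr (1 : F) \in G).
Hypothesis eigG : forall g, g \in G -> exists2 v : F * F, v != 0 & eigv g v.
Implicit Types (g h : (GL2 F)) (v w : F * F).

Local Notation f := (#|F|.-1).
Local Notation act := (pair_action F).
Local Notation st v := ('C_G[v | act])%g.
Local Notation Om := (row01_orbit G).
Local Notation e2 := (row01 F).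
Local Notation B := (Utr_entries G).
Local Notation q := #|B|.

(* With row01, these slopes parametrise the lines of the orbit of row01. *)
Definition slopes := [set z : F | (1, z) \in Om].

Lemma card_Om : #|Om| = (f * #|slopes|.+1)%N.
Proof.
rewrite -(cardsID [set v : F * F | v.1 == 0]) mulnS; congr (_ + _)%N.
  rewrite -card_units -[RHS](card_imset _ (f := fun a : F => (0 : F, a))); last by move=> a b [].
  congr #|pred_of_set _|; apply/setP=> -[x y]; rewrite in_setI in_set /=.
  apply/andP/imsetP => [[Omv /eqP x0]|[a]].
    exists y; rewrite x0 in Omv * => //; rewrite in_set; apply: contraTneq Omv => ->.
    by apply/negP=> /(Om_neq0)/eqP.
  rewrite in_set => na [-> ->]; split=> //.
  by have := Om_sc sScG e2 na; rewrite /sc mulr0 mulr1 Om_e2.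
rewrite -card_units -cardsX.
rewrite -[RHS](card_in_imset (f := fun az : F * F => (az.1, az.1 * az.2))); last first.
  move=> [a z] [a' z']; rewrite !in_setX !in_set /= => /andP[na _] /andP[na' _] [<-].
  by move/(mulfI na) ->.
congr #|pred_of_set _|; apply/setP=> -[x y]; rewrite in_setD in_set /=.
apply/andP/imsetP => [[nx Omv]|[[a z]]].
  exists (x, y / x); last by rewrite /= mulrC divfK.
  rewrite in_setX !in_set /= nx -(Om_sc sScG _ nx) /sc /= mulr1 mulrC divfK //.
rewrite in_setX !in_set /= => /andP[na Omz] [-> ->]; split=> //.
by have := Om_sc sScG (1, z) na; rewrite /sc mulr1 Omz.
Qed.

Lemma f_gt0 : (0 < f)%N.
Proof. by have := finRing_gt1 F; case: #|F| => [|[]]. Qed.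

Lemma sum_st_orbit v : (\sum_(w in orbit act G v) #|st w| = #|G|)%N.
Proof.
rewrite -(card_orbit_stab act G v) -sum_nat_const; apply: eq_bigr => w Ow.
apply/eqP; rewrite -(eqn_pmul2l (_ : 0 < #|orbit act G v|)%N); last first.
  by apply/card_gt0P; exists v; apply: orbit_refl.
by rewrite card_orbit_stab -(orbit_eqP Ow) card_orbit_stab.
Qed.

Local Notation V := [set v : F * F | v != 0].

(* Double count of pairs (g, v) with v an eigenvector of g: a non-scalar g has two
   eigenlines, or a single one if its characteristic polynomial is a square, and
   then this line lies in the orbit of row01. *)
Lemma sum_eigv :
  (\sum_(v in V) #|st v| * f + #|Om| * (f * q.-1) = f * (f * f.+2) + (#|G| - f) * (2 * f))%N.
Proof.
have -> : (\sum_(v in V) #|st v| * f = \sum_(g in G) #|[set v in V | eigv g v]|)%N.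
  by rewrite -double_count; apply: eq_bigr => v; rewrite in_set => nv; rewrite -line_stab_card.
have -> : (#|Om| * (f * q.-1) = \sum_(g in G) uni g * f)%N.
  transitivity (\sum_(g in [set g in G | uni g]) #|[set v in V | eigv g v]|)%N.
    rewrite -double_count.
    have sOV : Om \subset V by apply/subsetP=> v /Om_neq0; rewrite in_set.
    rewrite (big_setID Om) /= (setIidPr sOV) [X in (_ = _ + X)%N]big1 ?addn0 => [|v].
      rewrite -sum_nat_const; apply: eq_bigr => v Ov; rewrite -(card_uni_Om sScG Ov).
      by apply: eq_card => g; rewrite !in_set andbA.
    rewrite in_setD in_set => /andP[nO nv]; apply/eqP; rewrite cards_eq0.
    apply/eqP/setP=> g; rewrite in_set0 !in_set; apply/negP=> /andP[/andP[Gg ug] eg].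
    case/negP: nO; have [nSc /eqP d0] := andP ug; have [a na ea] := eigvP g nv eg.
    pose k := (g * (scal a)^-1)%g.
    have Gk : k \in G by apply: inGM => //; apply/inGV/scal_in.
    have fk : pact v k = v by rewrite pactM ea -pact_scal // -pactM mulgV pact1.
    have gk : g = (k * scal a)%g by rewrite mulgKV.
    have nk : k != 1%g.
      by apply: contraNneq nSc => k1; rewrite gk k1 mul1g; apply/scalarsP; exists a.
    have tk : gtr g = a * gtr k.
      rewrite gk /gtr mxM scalE // [mx k]mx2_eta mul_mx2 !mx2E; ring.
    have dk : gdet g = a ^+ 2 * gdet k.
      rewrite gk gdetM [gdet (scal a)]/gdet scalE // !mx2E; ring.
    have d0k : gtr k ^+ 2 = 4 * gdet k.
      have na2 : a ^+ 2 != 0 by rewrite expf_neq0.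
      apply: (mulfI na2); rewrite [RHS]mulrCA -dk -exprMn -tk; apply/eqP; rewrite -subr_eq0 -discE.
      exact/eqP.
    (* Since k fixes v, 1 is a root of its characteristic polynomial, which is a square and hence
       equals (X - 1)^2. *)
    have cp : 1 - gtr k + gdet k = 0.
      case: v nv fk {ea eg Gg} => x y; rewrite pair_eq0 negb_and => nv fk.
      have e1 : x * (mx k 0 0 - 1) + y * mx k 1 0 = 0.
        by rewrite mulrBr mulr1 addrAC -[x * _ + _]/((pact (x, y) k).1) fk subrr.
      have e2 : x * mx k 0 1 + y * (mx k 1 1 - 1) = 0.
        by rewrite mulrBr mulr1 addrA -[x * _ + _]/((pact (x, y) k).2) fk subrr.
      case/orP: nv => nz; apply: (mulfI nz); rewrite mulr0.
        rewrite (_ : _ * _ = (mx k 1 1 - 1) * (x * (mx k 0 0 - 1) + y * mx k 1 0) - mx k 1 0 * (x * mx k 0 1 + y * (mx k 1 1 - 1))).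
          by rewrite e1 e2 !mulr0 subrr.
        by rewrite /gtr /gdet; ring.
      rewrite (_ : _ * _ = (mx k 0 0 - 1) * (x * mx k 0 1 + y * (mx k 1 1 - 1)) - mx k 0 1 * (x * (mx k 0 0 - 1) + y * mx k 1 0)).
        by rewrite e1 e2 !mulr0 subrr.
      by rewrite /gtr /gdet; ring.
    have t2 : gtr k = 2.
      have : (gtr k - 2) ^+ 2 = 0.
        rewrite (_ : _ ^+ 2 = gtr k ^+ 2 - 4 * gdet k + 4 * (1 - gtr k + gdet k)); last by ring.
        by rewrite d0k cp subrr mulr0 addr0.
      by move/eqP; rewrite expf_eq0 /= subr_eq0 => /eqP.
    apply: (unipotent_fix_Om p_pr chF sScG uG Gk) => //.
    by move/eqP: cp; rewrite t2 -subr_eq0 => /eqP cp; rewrite -[LHS](subr0) -cp; ring.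
  rewrite (eq_bigl (fun g => (g \in G) && uni g)) => [|g]; last by rewrite in_set.
  rewrite big_mkcondr /=; apply: eq_bigr => g Gg; case: ifP => // ug.
  have [nSc _] := andP ug; have := card_eigv (char_odd_neq0 p_gt2 chF) nSc (eigG Gg).
  rewrite ug mul1n mul2n -addnn => /addIn <-.
  by apply: eq_card => v; rewrite !in_set.
rewrite -big_split /= (big_setID (scalars F)) /= (setIidPr sScG).
rewrite (eq_bigr (fun=> (f * f.+2)%N)) => [|g Sg]; last first.
  rewrite /uni Sg addn0 (_ : f.+2 = #|F|.+1); last by rewrite prednK // (ltn_trans _ (finRing_gt1 F)).
  rewrite -card_pairs_neq0; apply: eq_card => v; rewrite !in_set eigv_scalar ?andbT //.
rewrite [X in (_ + X)%N](eq_bigr (fun=> (2 * f)%N)) => [|g]; last first.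
  rewrite in_setD => /andP[nSc Gg]; rewrite -(card_eigv (char_odd_neq0 p_gt2 chF) nSc (eigG Gg)).
  by congr (_ + _)%N; apply: eq_card => v; rewrite !in_set.
by rewrite !sum_nat_const card_scalars cardsD (setIidPr sScG) card_scalars.
Qed.

Lemma card_B_pow : exists k, q = (p ^ k.+1)%N.
Proof.
have := card_pgroup (@Utr_pgroup F p G p_pr chF); rewrite card_Utr_set.
case: logn => [|k ->]; last by exists k.
rewrite expn0 => q1; have: (1 < q)%N.
  by rewrite (cardsD1 0) B0 (cardsD1 1) in_setD1 oner_neq0 B1.
by rewrite q1.
Qed.

Lemma card_B_gt2 : (2 < q)%N.
Proof.
have [k ->] := card_B_pow; apply: leq_trans p_gt2 _.
by rewrite -{1}[p]expn1 leq_exp2l // prime_gt1.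
Qed.

Lemma card_G : #|G| = (f * #|slopes|.+1 * (#|dirs G| * q))%N.
Proof. by rewrite -card_Om -card_st_e2 // card_orbit_stab. Qed.

(** The vectors in the orbit of [row01] contribute |G| to [sum_eigv]; the rest follows by cancelling
    a factor f. *)
Lemma sum_st_out :
  (\sum_(v in V :\: Om) #|st v| + f * #|slopes|.+1 * q.-1 = f * f + #|G|)%N.
Proof.
have sOV : Om \subset V by apply/subsetP=> v /Om_neq0; rewrite in_set.
have := sum_eigv; rewrite -big_distrl /= (big_setID Om) /= (setIidPr sOV) sum_st_orbit card_Om.
have fG : (f <= #|G|)%N by rewrite -card_scalars subset_leq_card.
move=> eqs; have := f_gt0 => f0; apply/eqP; rewrite -(eqn_pmul2l f0); apply/eqP.
move: eqs; rewrite -(subnKC fG) addKn.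
move: (\sum_(_ in _) _)%N (#|G| - f)%N #|slopes|.+1 q.-1 => W g n r.
move: f => k; lia.
Qed.

(* Put n = #|slopes|.+1. Outside of the orbit of row01 at most one orbit has nontrivial
   stabilisers; its length is f * (n * (q - 2) + 2), and if there is none then
   n * (q - 2) + 2 = n * q * #|dirs G|. *)
Lemma slopes_dvdn :
  (#|slopes|.+1 * (q - 2) + 2 %| #|slopes|.+1 * q * #|dirs G|)%N.
Proof.
have q2 := card_B_gt2; have f0 := f_gt0; have eqW := sum_st_out; have eqG := card_G.
have sOV : Om \subset V by apply/subsetP=> v /Om_neq0; rewrite in_set.
have cD : (#|V :\: Om| + f * #|slopes|.+1 = f * f.+2)%N.
  rewrite cardsD (setIidPr sOV) card_pairs_neq0 -card_Om subnK.
    by rewrite (_ : f.+2 = #|F|.+1) // prednK // (ltn_trans _ (finRing_gt1 F)).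
  by rewrite -card_pairs_neq0 subset_leq_card.
have st_gt0 v : (0 < #|st v|)%N := cardG_gt0 _.
have orb_out v : v \in V :\: Om -> orbit act G v \subset V :\: Om.
  rewrite !in_setD in_set => /andP[nO nv]; apply/subsetP=> _ /orbitP[g Gg /= <-].
  by rewrite !in_setD in_set pact_eq0 Om_stable // nO.
have orb_big v (X : {set F * F}) : orbit act G v \subset X ->
   (#|G| + \sum_(w in X :\: orbit act G v) #|st w| = \sum_(w in X) #|st w|)%N.
  by move=> sX; rewrite [RHS](big_setID (orbit act G v)) /= (setIidPr sX) sum_st_orbit.
have triv_sum (X : {set F * F}) : {in X, forall w, #|st w| = 1%N} -> (\sum_(w in X) #|st w| = #|X|)%N.
  by move=> st1; rewrite (eq_bigr (fun=> 1%N)) // sum1_card.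
have ge_sum (X : {set F * F}) : (#|X| <= \sum_(w in X) #|st w|)%N.
  by rewrite -sum1_card leq_sum.
set n := #|slopes|.+1 in eqW eqG cD *; set d := #|dirs G| in eqG *.
case: (boolP [forall v in V :\: Om, #|st v| == 1%N]) => [/forall_inP st1 | ].
  rewrite triv_sum in eqW => [|v /st1/eqP//].
  suffices ->: (n * (q - 2) + 2 = n * q * d)%N by [].
  by apply/eqP; rewrite -(eqn_pmul2l f0); apply/eqP; exact: (orbit_arith0 q2 eqW cD eqG).
rewrite negb_forall_in => /exists_inP[v0 Dv0 nst0].
have st0 : (1 < #|st v0|)%N by rewrite ltn_neqAle eq_sym nst0 st_gt0.
have sO0 := orb_out _ Dv0; have eq0 := orb_big _ _ sO0.
have o0 := card_orbit_stab act G v0.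
case: (boolP [forall v in (V :\: Om) :\: orbit act G v0, #|st v| == 1%N]) => [/forall_inP st1 | ].
  rewrite triv_sum in eq0 => [|v /st1/eqP//].
  have cD0 : (#|(V :\: Om) :\: orbit act G v0| + #|orbit act G v0| = #|V :\: Om|)%N.
    by rewrite cardsD (setIidPr sO0) subnK // subset_leq_card.
  have eo : #|orbit act G v0| = (f * (n * (q - 2) + 2))%N.
    exact: (orbit_arith1 q2 eqW cD eq0 cD0).
  apply/dvdnP; exists #|st v0|; apply/eqP; rewrite -(eqn_pmul2l f0); apply/eqP.
  by rewrite eo eqG in o0; move: o0; move: (n * (q - 2) + 2)%N => X; lia.
(* A second outer orbit with nontrivial stabilisers is impossible by [orbit_arith2]. *)
rewrite negb_forall_in => /exists_inP[v1 Dv1 nst1].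
have st1 : (1 < #|st v1|)%N by rewrite ltn_neqAle eq_sym nst1 st_gt0.
have o1 := card_orbit_stab act G v1.
have sO1 : orbit act G v1 \subset (V :\: Om) :\: orbit act G v0.
  move: Dv1; rewrite in_setD => /andP[n01 Dv1].
  rewrite subsetD orb_out //=; apply/pred0P=> w /=; apply/negP=> /andP[w1 w0].
  by case/negP: n01; rewrite -(orbit_eqP w0) (orbit_eqP w1) orbit_refl.
have eq1 := orb_big _ _ sO1.
have cD0 : (#|(V :\: Om) :\: orbit act G v0| + #|orbit act G v0| = #|V :\: Om|)%N.
  by rewrite cardsD (setIidPr sO0) subnK // subset_leq_card.
have cD1 : (#|((V :\: Om) :\: orbit act G v0) :\: orbit act G v1| + #|orbit act G v1| =
    #|(V :\: Om) :\: orbit act G v0|)%N.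
  by rewrite cardsD (setIidPr sO1) subnK // subset_leq_card.
have := ge_sum (((V :\: Om) :\: orbit act G v0) :\: orbit act G v1).
have h0 : (2 * #|orbit act G v0| <= #|G|)%N by rewrite -o0 mulnC leq_mul.
have h1 : (2 * #|orbit act G v1| <= #|G|)%N by rewrite -o1 mulnC leq_mul.
by move=> h2; have := orbit_arith2 f0 q2 eqW cD eq0 eq1 h2 cD1 cD0 h0 h1.
Qed.

End OrbitCount.

(** * The two possible sets of slopes, and an element with rational parameter *)

Section Endgame.

Import GRing.Theory.
Local Open Scope ring_scope.

Variables (F : finFieldType) (p : nat) (G : {group (GL2 F)}).
Hypotheses (p_pr : prime p) (p_gt2 : (2 < p)%N) (chF : p \in [pchar F]).
Hypotheses (sScG : scalars F \subset G) (uG : Utr (1 : F) \in G).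
Hypothesis movG : exists2 g, g \in G & mx g 1 0 != 0.
Hypothesis eigG : forall g, g \in G -> exists2 v : F * F, v != 0 & eigv g v.
Implicit Types (g h : (GL2 F)) (v w : F * F).

Local Notation act := (pair_action F).
Local Notation Om := (row01_orbit G).
Local Notation e2 := (row01 F).
Local Notation B := (Utr_entries G).
Local Notation q := #|B|.
Local Notation Z := (slopes G).

Lemma slopesD z b : z \in Z -> b \in B -> z + b \in Z.
Proof.
rewrite !in_set => Oz Bb; have := Om_stable (1, z) Bb.
by rewrite pact_Utr /= mul1r addrC Oz.
Qed.

Lemma slopes_gt0 : (0 < #|Z|)%N.
Proof.
have [g Gg ng] := movG; apply/card_gt0P; exists (mx g 1 1 / mx g 1 0).
rewrite in_set -(Om_sc sScG _ ng) /sc /= mulr1 mulrC divfK //.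
by have := OmP Gg; rewrite /pact /= !mul0r !mul1r !add0r.
Qed.

(** The group of the [Utr b] in G acts freely on the slopes, by translations. *)
Lemma dvdn_slopes : (q %| #|Z|)%N.
Proof.
pose X := [set ((1 : F), z) | z in Z].
have -> : #|Z| = #|X| by rewrite card_imset // => a b [].
have actsX : [acts Utr_group G, on X | act]%g.
  apply/actsP=> _ /imsetP[b Bb ->] w; apply/imsetP/imsetP => -[z Zz /= ew]; last first.
    exists (z + b); first by rewrite slopesD.
    by rewrite ew pact_Utr /= mul1r addrC.
  exists (z - b); first by apply: slopesD => //; apply: (BN p_pr chF).
  by move: ew; rewrite pact_Utr; case: w => x y /= [-> <-]; rewrite mul1r addrC addKr.
rewrite -(acts_sum_card_orbit actsX); apply: dvdn_sum => _ /imsetP[v Xv ->].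
rewrite -card_Utr_set card_orbit; have /imsetP[z Zz ->] := Xv.
rewrite (_ : 'C_(Utr_group G)[_ | act]%g = 1%G) ?indexg1 //.
apply/trivgP/subsetP=> g; rewrite in_setI => /andP[/imsetP[b Bb ->] /astab1P /= eb].
rewrite inE; move: eb; rewrite pact_Utr /= => -[]; rewrite mul1r => /eqP.
by rewrite -subr_eq0 addrK => /eqP->; rewrite Utr0.
Qed.

Lemma dirs_gt0 : (0 < #|dirs G|)%N.
Proof.
apply/card_gt0P; exists (mx (1%g : GL2 F) 0 0); apply: imset_f; exact: group1.
Qed.

(** In the second case G has order 10 * 2 * 3 = 60 modulo scalars: this is the icosahedral case in
    characteristic 3. *)
Lemma slopes_cases : #|Z| = q \/ [/\ q = 3, #|Z| = 9 & #|dirs G| = 2]%N.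
Proof.
have /dvdnP[k cZ] := dvdn_slopes; have Z0 := slopes_gt0.
have [j qp] := card_B_pow p_pr chF uG.
have oq : odd q by rewrite qp oddX; case: (even_prime p_pr) p_gt2 => [->|->]; rewrite ?orbT.
have k0 : (0 < k)%N by move: Z0; rewrite cZ muln_gt0 => /andP[].
have := slopes_arith (card_B_gt2 p_pr p_gt2 chF uG) oq k0 dirs_gt0 (card_dirs uG).
rewrite -cZ; case/(_ (slopes_dvdn p_pr p_gt2 chF sScG uG eigG)) => [k1 | [q3 k3 d2]].
  by left; rewrite cZ k1 mul1n.
by right; rewrite cZ k3 q3.
Qed.

(* The transvections with axis spanned by (1, z). *)
Definition transv (z c : F) : GL2 F := mkGL (1 + c * z) (c * z ^+ 2) (- c) (1 - c * z).

Lemma transvE z c : mx (transv z c) = mx2 (1 + c * z) (c * z ^+ 2) (- c) (1 - c * z).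
Proof. by rewrite mkGLE // (_ : _ - _ = 1) ?oner_neq0 //; ring. Qed.

Lemma transv_det z c : gdet (transv z c) = 1.
Proof. by rewrite /gdet transvE !mx2E; ring. Qed.

(** This is the conjugate of [Utr b] by g, where g carries the axis of [Utr b] to the line of (1,
    z). *)
Lemma transv_in g z b : g \in G -> pact e2 g = (1, z) -> b \in B -> transv z (b / gdet g) \in G.
Proof.
move=> Gg eg; rewrite mem_B => Bb; have := inGM (inGV Gg) (inGM Bb Gg); congr (_ \in G).
apply: (canLR (mulKg _)); apply: mx_inj; rewrite !mxM UtrE transvE.
have [c1 d1] : mx g 1 0 = 1 /\ mx g 1 1 = z.
  have := congr1 fst eg; have := congr1 snd eg.
  by rewrite /pact /= !mul0r !mul1r !add0r.
have nd := gdet_neq0 g; move: nd; rewrite /gdet c1 d1 mulr1 => nd.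
by rewrite [mx g]mx2_eta c1 d1 !mul_mx2; apply: eq_mx2; rewrite !mx2E; field.
Qed.

Lemma slopes_transv z c : z \in Z -> c != 0 -> transv z c \in G -> z - c^-1 \in Z.
Proof.
move=> Zz nc GY; rewrite in_set -(Om_sc sScG _ (_ : - c != 0)) ?oppr_eq0 //.
have -> : sc (- c) (1, z - c^-1) = pact e2 (transv z c).
  by rewrite /pact transvE !mx2E /sc /=; congr (_, _); field.
exact: OmP.
Qed.

Lemma slopes_transv_shift z c t : 
  z + t \in Z -> 1 - c * t != 0 -> transv z c \in G -> z + t / (1 - c * t) \in Z.
Proof.
rewrite !in_set => Zz nc GY; rewrite -(Om_sc sScG _ nc).
rewrite -(Om_stable _ GY) in Zz; congr (_ \in Om): Zz.
by rewrite /pact transvE !mx2E /sc /=; congr (_, _); field.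
Qed.

(** The prime field is the set of the [j%:R]. As [gdet h] is nonzero, both j and the entry are
    nonzero in F, so the ratio is rational in either direction. *)
Definition rational_entry := exists2 h, h \in G & exists j : nat, mx h 1 0 ^+ 2 * j%:R = gdet h.

Lemma rational_entry_sq h : h \in G -> gdet h = 1 -> mx h 1 0 ^+ 2 = 1 -> rational_entry.
Proof. by move=> Gh d1 h1; exists h => //; exists 1%N; rewrite h1 d1 mulr1. Qed.

(** Here the slopes form one coset z + B. The transvection with parameter b / d sends the line of
    [row01] to slope z - d / b, so b |-> d / b permutes the nonzero elements of B. It takes the
    value 1, hence d lies in B, and [transv z 1] lies in G. *)
Lemma rational_entry_generic : #|Z| = q -> rational_entry.
Proof.
move=> cZ; have [z Zz] := card_gt0P slopes_gt0.
have [g Gg eg] := Om_orbit (etrans (esym (in_set _ _)) Zz : (1, z) \in Om).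
pose d := gdet g; have nd : d != 0 := gdet_neq0 g.
have ZB : Z = [set z + b | b in B].
  apply/eqP; rewrite eq_sym eqEcard cZ card_imset ?leqnn ?andbT; last exact: addrI.
  by apply/subsetP=> _ /imsetP[b Bb ->]; apply: slopesD.
have dB b : b \in B -> b != 0 -> d / b \in B.
  move=> Bb nb; have nc : b / d != 0 by rewrite mulf_neq0 ?invr_eq0.
  have := slopes_transv Zz nc (transv_in Gg (esym eg) Bb); rewrite ZB => /imsetP[b' Bb'].
  by move/addrI => eb; rewrite -[d / b]opprK -invf_div eb; apply: (BN p_pr chF).
have Bd : d \in B.
  have : [set d / b | b in B :\ 0] = B :\ 0.
    apply/eqP; rewrite eqEcard card_in_imset ?leqnn ?andbT.
      apply/subsetP=> _ /imsetP[b /setD1P[nb Bb] ->].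
      by rewrite !inE mulf_neq0 ?invr_eq0 //= -mem_B dB.
    by move=> a b _ _ /(mulfI nd)/invr_inj.
  move/setP/(_ 1); rewrite in_setD1 oner_neq0 B1 // => /imsetP[b /setD1P[nb Bb] eb].
  by rewrite -[d](divfK nb) -eb mul1r.
apply: (@rational_entry_sq (transv z (d / d))); rewrite ?transv_det //.
  by apply: transv_in => //.
by rewrite transvE !mx2E divff // sqrrN expr1n.
Qed.

Lemma odd_involution_fix (T : finType) (X : {set T}) (s : T -> T) :
  involutive s -> {in X, forall x, s x \in X} -> odd #|X| -> exists2 x, x \in X & s x = x.
Proof.
move=> ss sX oX; pose t := perm (inv_inj ss).
have tE x : t x = s x by rewrite permE.
have t2 : (t ^+ 2 = 1)%g by apply/permP=> x; rewrite expgS expg1 permM !tE ss perm1.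
have p2 : (2.-group <[t]>)%g by rewrite /pgroup (pnat_dvd _ (pnat_id _)) // order_dvdn t2.
have actsX : [acts <[t]>, on X | 'P]%g.
  rewrite cycle_subG !inE /=; apply/subsetP=> x Xx.
  by rewrite inE /= apermE tE sX.
have := pgroup_fix_mod p2 actsX; rewrite !modn2 oX => oF.
have : (0 < #|'Fix_(X | 'P)(<[t]>)|%g)%N by case: #|_| oF.
case/card_gt0P=> x /setIP[Xx /afixP fx]; exists x => //.
by rewrite -tE; apply: (fx t (cycle_id t)).
Qed.

(* Unless d is in B = F_3 the slopes are z + {0, d, -d} + B, and stability under
   t |-> t / (1 - c t) forces d to be a root of one of three quadratics over F_3. *)
Lemma rational_entry_exceptional : (q = 3 -> #|Z| = 9 -> #|dirs G| = 2 -> rational_entry)%N.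
Proof.
move=> q3 Z9 d2.
have p3 : p = 3%N.
  have [j] := card_B_pow p_pr chF uG; rewrite q3 => e3.
  have : (p %| 3)%N by rewrite e3 expnS dvdn_mulr.
  by rewrite dvdn_prime2 // => /eqP.
have c3 : (3 : F) = 0 by have := pcharf0 chF; rewrite p3.
have two : (2 : F) = -1 by apply/eqP; rewrite -subr_eq0 opprK natr1 c3.
have BN1 : - (1 : F) \in B by apply: (BN p_pr chF); apply: B1.
have n11 : (1 : F) != - 1 by rewrite -two -[1]/(1%:R) eq_sym -subr_eq0 -natrB // oner_eq0.
have eB : B = [set 0; 1; -1].
  apply/eqP; rewrite eq_sym eqEcard; apply/andP; split.
    apply/subsetP=> b; rewrite !inE -orbA => /or3P[] /eqP->; rewrite -mem_B ?BN1 ?B1 ?B0 //.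
  by rewrite q3 -setUA !cardsU1 cards1 !inE ![0 == _]eq_sym oppr_eq0 !oner_eq0 (negPf n11).
have dN1 : -1 \in dirs G.
  have eD : dirs G = [set 1; -1].
    apply/eqP; rewrite eqEcard d2 cards2 n11 andbT; apply/subsetP=> a /(dirs_B uG)[na].
    by rewrite eB !inE (negPf na).
  by rewrite eD !inE eqxx orbT.
have [h0 /st_e2P[Gh0 h10 h11] ha] := imsetP dN1.
pose b := mx h0 0 1.
(* The element h0 of the stabiliser has top left entry -1, so it acts on slopes as a reflection. The
   number of slopes is odd, so one of them is fixed and serves as origin. *)
have sZ z : z \in Z -> - z - b \in Z.
  rewrite !in_set => Oz; rewrite -(Om_stable _ Gh0) in Oz.
  have nN1 : -1 != 0 :> F by rewrite oppr_eq0 oner_eq0.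
  rewrite -(Om_sc sScG _ nN1); congr (_ \in Om): Oz.
  by rewrite /pact h10 h11 -ha /sc /= -/b; congr (_, _); ring.
have [z Zz ez] : exists2 z, z \in Z & - z - b = z.
  by apply: odd_involution_fix => //; [move=> z; ring | rewrite Z9].
have eb : b = z.
  have : 3 * z = 0 by rewrite c3 mul0r.
  move=> ez3; have -> : b = - z - (- z - b) by ring.
  by rewrite ez -[RHS]subr0 -ez3; ring.
have sR t : z + t \in Z -> z - t \in Z.
  move=> Zt; have := sZ _ Zt; rewrite eb; congr (_ \in Z).
  by rewrite -[LHS]addr0 -(mul0r z) -c3; ring.
have [g Gg eg] := Om_orbit (etrans (esym (in_set _ _)) Zz : (1, z) \in Om).
pose d := gdet g; have nd : d != 0 := gdet_neq0 g; pose c := d^-1.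
have nc : c != 0 by rewrite invr_eq0.
have GY : transv z c \in G by rewrite /c -[_^-1]mul1r; apply: transv_in => //; apply: B1.
have [Bd | nBd] := boolP (d \in B).
  apply: (rational_entry_sq GY (transv_det _ _)); rewrite transvE !mx2E sqrrN /c exprVn.
  by move: Bd; rewrite eB !inE (negPf nd) /= => /orP[] /eqP->; rewrite ?sqrrN expr1n invr1.
have Zd : z + d \in Z.
  by have := sR _ (slopes_transv Zz nc GY : z + - c^-1 \in Z); rewrite opprK /c invrK.
have ndB e : e \in B -> d != e by move=> Be; apply: contraNneq nBd => ->.
pose T (a : F) := [set z + a + e | e in B].
have cT a : #|T a| = 3%N by rewrite card_imset ?q3 //; apply: addrI.
have sT a : z + a \in Z -> T a \subset Z.
  by move=> Za; apply/subsetP=> _ /imsetP[e Be ->]; apply: slopesD.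
have memT a x : (z + x \in T a) = (x - a \in B).
  apply/imsetP/idP => [[e Be] | Bx]; last by exists (x - a) => //; ring.
  by rewrite -addrA => /addrI->; rewrite addrAC subrr add0r.
have dT a a' : a - a' \notin B -> T a :&: T a' = set0.
  move=> na; apply/setP=> x; rewrite in_setI in_set0; apply/negP.
  rewrite -[x](addrNK z) addrC !memT => /andP[h1 h2]; case/negP: na.
  by have := BD h2 (BN p_pr chF h1); congr (_ \in B); ring.
have n0d : 0 - d \notin B.
  by apply: contra nBd => /(BN p_pr chF); rewrite sub0r opprK.
have n0Nd : 0 - - d \notin B by rewrite sub0r opprK.
have ndNd : d - - d \notin B.
  rewrite opprK -mulr2n -mulr_natr two mulrN1 -sub0r //.
have eZ : Z = T 0 :|: T d :|: T (- d).
  apply/esym/eqP; rewrite eqEcard !subUset !sT ?addr0 ?sR //=.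
  by rewrite Z9 cardsU setIUl !dT // setU0 cards0 cardsU dT // cards0 !cT.
have n1c : 1 - c * 1 != 0.
  rewrite mulr1 subr_eq0 eq_sym invr_eq1; apply: ndB; exact: B1.
have := slopes_transv_shift (slopesD Zz (B1 uG)) n1c GY.
set x := 1 / _; have xE : x = d / (d - 1).
  have nd1 : d - 1 != 0 by rewrite subr_eq0 ndB ?B1.
  rewrite /x /c; field; rewrite nd nd1 //.
have nd1 : d - 1 != 0 by rewrite subr_eq0 ndB ?B1.
have xd : x * (d - 1) = d by rewrite xE divfK.
rewrite eZ !in_setU !memT subr0 opprK eB !in_setU !in_set1.
have d1 : d != 1 by apply/ndB/B1.
have dm1 : d != -1 by apply: ndB.
have pol a : x = a -> a * (d - 1) - d = 0 by move=> <-; rewrite xd subrr.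
(* Lets [ring] compute modulo 3; y is the multiple to be discarded. *)
have m3 (a y : F) : a + 3 * y = 0 -> a = 0 by rewrite c3 mul0r addr0.
have GU1 : Utr (1 : F) \in G by [].
have GUN1 : Utr (-1 : F) \in G by rewrite -mem_B.
(* With Y = [transv z c], the elements Y and Y * [Utr j] * Y have lower left entries - c and c + j
   c^2 modulo 3. Each of the three quadratics for d = 1 / c makes the square of one of them 1 or
   -1. *)
have YUY j : mx (transv z c * (Utr j * transv z c))%g 1 0 = - 2 * c + j * c ^+ 2.
  by rewrite !mxM UtrE transvE !mul_mx2 !mx2E; ring.
have YUYd j : gdet (transv z c * (Utr j * transv z c))%g = 1.
  by rewrite !gdetM !transv_det Utr_det !mulr1.
have invc a1 a0 : d ^+ 2 + a1 * d + a0 = 0 -> 1 + a1 * c + a0 * c ^+ 2 = 0.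
  move=> e0; have -> : 1 + a1 * c + a0 * c ^+ 2 = (d ^+ 2 + a1 * d + a0) * c ^+ 2.
    by rewrite /c; field.
  by rewrite e0 mul0r.
case/orP=> [/orP[]|]; rewrite -orbA => /or3P[] /eqP ex.
- by case/eqP: nd; rewrite -xd ex mul0r.
- have := pol _ ex; rewrite mul1r addrAC subrr sub0r => /eqP.
  by rewrite oppr_eq0 oner_eq0.
- case/eqP: dm1; apply/eqP; rewrite -subr_eq0 opprK; apply/eqP/(m3 _ (- d)).
  by rewrite -[RHS](pol _ ex); ring.
- case/eqP: dm1; apply/eqP; rewrite -subr_eq0 opprK; apply/eqP/(mulfI nd).
  rewrite mulr0; apply: (m3 _ (- d)).
  by rewrite -[RHS](pol d) ?[x](canRL (subrK _) ex) ?add0r //; ring.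
- have eA : d ^+ 2 + (-1) * d + (-1) = 0.
    by rewrite -[RHS](pol (1 + d)) ?[x](canRL (subrK _) ex) //; ring.
  apply: (rational_entry_sq (inGM GY (inGM GU1 GY)) (YUYd _)).
  rewrite YUY (_ : _ + _ = 1) ?expr1n //; apply/eqP; rewrite -subr_eq0; apply/eqP.
  apply: (m3 _ c); rewrite -[RHS]oppr0 -(invc _ _ eA); ring.
- have eC : d ^+ 2 + 0 * d + 1 = 0.
    apply: (m3 _ (- d)); rewrite -[RHS](pol (-1 + d)) ?[x](canRL (subrK _) ex) //; ring.
  (* Here c^2 = -1, and 2 is its inverse modulo 3. *)
  exists (transv z c) => //; exists 2%N; rewrite transv_det transvE !mx2E.
  apply/eqP; rewrite -subr_eq0; apply/eqP.
  apply: (m3 _ (- c ^+ 2)); rewrite -[RHS]oppr0 -(invc _ _ eC); ring.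
- have /eqP : - d ^+ 2 = 0; last by rewrite oppr_eq0 expf_eq0 /= (negPf nd).
  by rewrite -[RHS](pol (0 - d)) ?(canRL (addrK _) ex) //; ring.
- have /eqP : - (d + 1) ^+ 2 = 0.
    apply: (m3 _ d); rewrite -[RHS](pol (1 - d)) ?(canRL (addrK _) ex) //; ring.
  by rewrite oppr_eq0 expf_eq0 /= addr_eq0 (negPf dm1).
have eB' : d ^+ 2 + 1 * d + (-1) = 0.
  by rewrite -[RHS]oppr0 -(pol (-1 - d)) ?(canRL (addrK _) ex) //; ring.
apply: (rational_entry_sq (inGM GY (inGM GUN1 GY)) (YUYd _)).
rewrite YUY (_ : _ + _ = -1) ?sqrrN ?expr1n //; apply/eqP; rewrite -subr_eq0; apply/eqP.
apply: (m3 _ c); rewrite -(invc _ _ eB'); ring.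
Qed.

Theorem dickson_rational_entry : rational_entry.
Proof.
case: slopes_cases => [| [q3 Z9 d2]]; [exact: rational_entry_generic|].
exact: rational_entry_exceptional.
Qed.

End Endgame.

(** * A section isomorphic to Qd(p) *)

Section Frame.

Import GRing.Theory.
Local Open Scope ring_scope.

Variables (F : fieldType) (gT : finGroupType) (G : {group gT}) (n : nat).
Variables (rG : mx_representation F G n) (m : nat) (B : 'M[F]_(m, n)).
Hypothesis freeB : row_free B.

(** The matrix, in the basis formed by the rows of B, of the action on their span; it has this
    meaning only for h stabilising the span. *)
Definition frame_mx h := B *m rG h *m pinvmx B.

Lemma frame_mxK h : h \in rstabs rG B -> frame_mx h *m B = B *m rG h.
Proof. by rewrite inE => /andP[_ sB]; apply: mulmxKpV. Qed.

Lemma frame_mx_eq h (A : 'M_m) : A *m B = B *m rG h -> frame_mx h = A.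
Proof. by rewrite /frame_mx => <-; rewrite mulmxKp. Qed.

Lemma frame_stab h (A : 'M_m) : h \in G -> A *m B = B *m rG h -> h \in rstabs rG B.
Proof. by move=> Gh eA; rewrite inE Gh -eA submxMl. Qed.

Fact frame_mx_repr : mx_repr (rstabs rG B) frame_mx.
Proof.
split=> [|x y Sx Sy]; first by apply: frame_mx_eq; rewrite repr_mx1 mul1mx mulmx1.
have [/setIdP[Gx _] /setIdP[Gy _]] := (Sx, Sy).
by apply: frame_mx_eq; rewrite -mulmxA frame_mxK // mulmxA frame_mxK // repr_mxM // mulmxA.
Qed.
Canonical frame_repr := MxRepresentation frame_mx_repr.

End Frame.

Section Frame2.

Import GRing.Theory.
Local Open Scope ring_scope.

Variables (F : fieldType) (n : nat) (v1 v2 : 'rV[F]_n).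

Definition frame2 : 'M[F]_(2, n) := \matrix_(i < 2) (if i == 0 then v1 else v2).

Lemma rv2_frame a b : rv2 a b *m frame2 = a *: v1 + b *: v2.
Proof.
by apply/rowP=> j; rewrite !mxE sum2 !rv2E; congr (_ * _ + _ * _); rewrite !mxE.
Qed.

Lemma mx2_frame a b c d (A : 'M[F]_n) :
  v1 *m A = a *: v1 + b *: v2 -> v2 *m A = c *: v1 + d *: v2 ->
  mx2 a b c d *m frame2 = frame2 *m A.
Proof.
move=> e1 e2; apply/row_matrixP=> i; rewrite !row_mul rowK.
have -> : row i (mx2 a b c d) = if i == 0 then rv2 a b else rv2 c d.
  by apply: eq_rv2; rewrite !mxE; case: (ord2P i) => ->; rewrite !mxE.
by case: (ord2P i) => -> /=; rewrite rv2_frame ?e1 ?e2.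
Qed.

Lemma free_frame2 :
  (forall a b, a *: v1 + b *: v2 = 0 -> a = 0 /\ b = 0) -> row_free frame2.
Proof.
move=> indep; apply: inj_row_free => v; rewrite [v]rv2_eta rv2_frame => /indep[-> ->].
by apply/eqP; rewrite rv2_eq0 eqxx.
Qed.

End Frame2.

Section TransvectionGen.

Import GRing.Theory.
Local Open Scope ring_scope.

Variables (p : nat) (gT : finGroupType) (H : {group gT}).
Variables (rH : mx_representation 'F_p H 2) (s t : gT).
Hypotheses (Hs : s \in H) (Ht : t \in H).
Hypotheses (sE : rH s = mx2 1 0 1 1) (tE : rH t = mx2 1 1 0 1).

Lemma transvections_SL2 (A : 'M['F_p]_2) : \det A = 1 -> exists2 h, h \in H & rH h = A.
Proof.
have low (x : 'F_p) : exists2 g, g \in H & rH g = mx2 1 0 x 1.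
  rewrite -[x]natr_Zp; elim: (x : nat) => [|k [g Hg gE]].
    by exists 1%g => //; rewrite repr_mx1; apply: eq_mx2; rewrite !mxE.
  exists (g * s)%g; first by rewrite groupM.
  by rewrite repr_mxM // gE sE mul_mx2 -natr1; apply: eq_mx2; rewrite !mx2E; ring.
have upp (x : 'F_p) : exists2 g, g \in H & rH g = mx2 1 x 0 1.
  rewrite -[x]natr_Zp; elim: (x : nat) => [|k [g Hg gE]].
    by exists 1%g => //; rewrite repr_mx1; apply: eq_mx2; rewrite !mxE.
  exists (g * t)%g; first by rewrite groupM.
  by rewrite repr_mxM // gE tE mul_mx2 -natr1; apply: eq_mx2; rewrite !mx2E; ring.
(* For c nonzero the matrix is a product upper, lower, upper of unitriangular ones; the case c = 0
   is reduced to this by a lower factor. *)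
have gen a b c d : c != 0 -> a * d - b * c = 1 -> exists2 g, g \in H & rH g = mx2 a b c d.
  move=> nc det1; have [u Hu uE] := upp ((a - 1) / c); have [v Hv vE] := upp ((d - 1) / c).
  have [w Hw wE] := low c; exists (u * w * v)%g; first by rewrite !groupM.
  rewrite !repr_mxM ?groupM // uE wE vE !mul_mx2; apply: eq_mx2; rewrite !mx2E; try by field.
  have -> : b = (a * d - 1) / c by rewrite -det1; field.
  by field.
rewrite [A]mx2_eta det_mx2; set a := A 0 0; set b := A 0 1; set c := A 1 0; set d := A 1 1.
move=> det1; have [c0 | nc] := eqVneq c 0; last exact: gen.
have nd : d != 0.
  by apply: contra_eq_neq det1 => ->; rewrite c0 !mulr0 subr0 eq_sym oner_eq0.
have [l Hl lE] := low (-1).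
have [|h Hh hE] := gen (a + b) b d d nd; first by rewrite -det1 c0; ring.
exists (h * l)%g; first by rewrite groupM.
by rewrite repr_mxM // hE lE mul_mx2; apply: eq_mx2; rewrite !mx2E ?c0; ring.
Qed.

End TransvectionGen.

Section QdSection.

Import GRing.Theory.
Local Open Scope ring_scope.

Variables (p : nat) (gT : finGroupType) (G E : {group gT}).
Hypotheses (p_pr : prime p) (p_gt2 : (2 < p)%N).
Hypotheses (abelE : p.-abelem%g E) (ntE : E :!=: 1%g) (nsEG : (E <| G)%g).

Let nEG : G \subset 'N(E)%g := normal_norm nsEG.
Let rG := abelem_repr abelE ntE nEG.
Let rV := abelem_rV abelE ntE.
Let Vr := rVabelem abelE ntE.

Variables (s t : gT) (v1 v2 : 'rV['F_p](E)).
Hypotheses (Gs : s \in G) (Gt : t \in G) (nv1 : v1 != 0).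
Hypotheses (s1 : v1 *m rG s = v1) (s2 : v2 *m rG s = v2 + v1).
Hypotheses (t1 : v1 *m rG t = v1 + v2) (t2 : v2 *m rG t = v2).

Lemma free_v12 : row_free (frame2 v1 v2).
Proof.
apply: free_frame2 => a b e0; have b0 : b = 0.
  have : (a *: v1 + b *: v2) *m rG s = 0 by rewrite e0 mul0mx.
  rewrite mulmxDl -!scalemxAl s1 s2 scalerDr addrA e0 add0r => /eqP.
  by rewrite scaler_eq0 (negPf nv1) orbF => /eqP.
by move/eqP: e0; rewrite b0 scale0r addr0 scaler_eq0 (negPf nv1) orbF => /eqP->.
Qed.

Local Notation Bf := (frame2 v1 v2).
Local Notation ST0 := (rstabs rG Bf).
Let rST0 := frame_repr rG free_v12.

Definition ST := [set h in ST0 | \det (rST0 h) == 1].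

Lemma ST_group_set : group_set ST.
Proof.
apply/group_setP; split=> [|x y].
  by rewrite inE group1 repr_mx1 det1 eqxx.
rewrite ![_ \in ST]in_set => /andP[Sx /eqP dx] /andP[Sy /eqP dy].
by rewrite groupM //= (repr_mxM rST0) // det_mulmx dx dy mulr1 eqxx.
Qed.
Canonical ST_group := Group ST_group_set.

Lemma ST_sub0 : ST \subset ST0.
Proof. by apply/subsetP=> h; rewrite inE => /andP[]. Qed.

Let rST := subg_repr rST0 ST_sub0.
Local Notation phi := (reprGLm rST).

Lemma ST_subG : ST \subset G.
Proof. exact: subset_trans ST_sub0 (rstabs_sub _ _). Qed.

Lemma mem_ST h (A : 'M_2) : h \in G -> A *m Bf = Bf *m rG h -> \det A = 1 ->
  h \in ST /\ rST h = A.
Proof.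
move=> Gh eA dA; have Sh := frame_stab Gh eA.
have e : rST0 h = A := frame_mx_eq free_v12 eA.
by split=> //; rewrite inE Sh e dA eqxx.
Qed.

Lemma rSTM x y : x \in ST -> y \in ST -> rST (x * y)%g = rST x *m rST y.
Proof. exact: (repr_mxM rST). Qed.

Lemma rST1 : rST 1%g = 1%:M.
Proof. exact: (repr_mx1 rST). Qed.

Lemma phi_SL2 (A : 'M['F_p]_2) : \det A = 1 -> exists2 h, h \in ST & rST h = A.
Proof.
have [Ss es] : s \in ST /\ rST s = mx2 1 0 1 1.
  apply: mem_ST => //; last by rewrite det_mx2; ring.
  by apply: mx2_frame; rewrite ?s1 ?s2 !scale1r ?scale0r ?addr0 // addrC.
have [St et] : t \in ST /\ rST t = mx2 1 1 0 1.
  apply: mem_ST => //; last by rewrite det_mx2; ring.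
  by apply: mx2_frame; rewrite ?t1 ?t2 !scale1r ?scale0r ?add0r.
exact: transvections_SL2 Ss St es et A.
Qed.

Lemma phi_in_SL2 h : h \in ST -> phi h \in SL2 p.
Proof.
move=> Sh; rewrite inE (_ : GLval (phi h) = rST h); last exact: (val_reprGLm rST).
by move: Sh; rewrite inE => /andP[].
Qed.

Definition plane := (rV @*^-1 rowg Bf)%g.

Lemma planeP e : reflect (e \in E /\ (rV e <= Bf)%MS) (e \in plane).
Proof.
by rewrite !inE; apply: andP.
Qed.

Lemma ST_norm_plane : ST \subset 'N(plane)%g.
Proof.
apply/subsetP=> h Sh; rewrite inE; apply/subsetP=> _ /imsetP[e /planeP[Ee sB] ->].
have Gh := subsetP ST_subG h Sh; have S0h := subsetP ST_sub0 h Sh.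
apply/planeP; split; first by rewrite memJ_norm // (subsetP nEG).
by rewrite /rV (abelem_rV_J _ _ nEG) // (rstabs_act S0h).
Qed.

Definition plane_coord e := rV e *m pinvmx Bf.

Lemma plane_coordK e : e \in plane -> plane_coord e *m Bf = rV e.
Proof. by case/planeP=> _; apply: mulmxKpV. Qed.

Lemma plane_coordJ e h : e \in plane -> h \in ST -> plane_coord (e ^ h)%g = plane_coord e *m rST h.
Proof.
move=> E0e Sh; have [Ee _] := planeP _ E0e; have Gh := subsetP ST_subG h Sh.
have eJ : rV (e ^ h)%g = rV e *m rG h := abelem_rV_J abelE ntE nEG Ee Gh.
have rSTE : rST h = Bf *m rG h *m pinvmx Bf by [].
by rewrite rSTE {1}/plane_coord eJ -(plane_coordK E0e) !mulmxA.
Qed.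

Lemma rST_scalarJ (a : 'F_p) g h : g \in ST -> h \in ST -> rST h = a%:M -> rST (h ^ g)%g = a%:M.
Proof.
move=> Sg Sh eh; have Sg' : (g^-1)%g \in ST by rewrite groupV.
rewrite /conjg (rSTM Sg' (groupM Sh Sg)) (rSTM Sh Sg) eh mulmxA scalar_mxC -mulmxA.
by rewrite -(rSTM Sg' Sg) mulVg rST1 mulmx1.
Qed.

(** The preimage in [ST] of the centre of SL_2(p). *)
Definition pm1_set := [set h in ST | (rST h == 1%:M) || (rST h == (-1)%:M)].

Lemma pm1_setP h : reflect (h \in ST /\ exists b : bool, rST h = ((-1) ^+ b)%:M) (h \in pm1_set).
Proof.
rewrite [h \in pm1_set]in_set; apply: (iffP andP) => -[-> e]; split=> //.
  by case/orP: e => /eqP ->; [exists false; rewrite expr0 | exists true; rewrite expr1].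
by case: e => -[] ->; rewrite ?expr1 ?expr0 eqxx ?orbT.
Qed.

Lemma pm1_group_set : group_set pm1_set.
Proof.
apply/group_setP; split=> [|x y /pm1_setP[Sx [a ea]] /pm1_setP[Sy [b eb]]].
  by apply/pm1_setP; split; [exact: group1 | exists false; rewrite rST1].
apply/pm1_setP; split; first exact: groupM.
by exists (a (+) b); rewrite (rSTM Sx Sy) ea eb -scalar_mxM -signr_addb.
Qed.
Canonical pm1_group := Group pm1_group_set.

Lemma pm1_normal : (pm1_set <| ST)%g.
Proof.
apply/andP; split; first by apply/subsetP=> h /pm1_setP[].
apply/subsetP=> g Sg; rewrite inE; apply/subsetP=> _ /imsetP[h /pm1_setP[Sh [b eb]] ->].
by apply/pm1_setP; split; [exact: groupJ | exists b; apply: rST_scalarJ].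
Qed.

Lemma Fp_two_neq0 : (2 : 'F_p) != 0.
Proof. exact: char_odd_neq0 p_gt2 (pchar_Fp p_pr). Qed.

Lemma N1_neq1 : (-1)%:M != 1%:M :> 'M['F_p]_2.
Proof.
apply: contraNneq Fp_two_neq0 => /matrixP/(_ 0 0); rewrite !mxE eqxx !mulr1n => e.
have := addNr (1 : 'F_p); rewrite e -mulr2n => ->; exact: eqxx.
Qed.

(* By the Frattini argument N_ST(T) still maps onto SL_2(p); it meets the plane
   trivially because T contains an element inverting the plane. *)
Section SylowNormalizer.

Variable T : {group gT}.
Hypothesis sylT : (2.-Sylow(pm1_set) T)%g.

Let sTK : T \subset pm1_set := pHall_sub sylT.
Let sTS : T \subset ST := subset_trans sTK (normal_sub pm1_normal).

(** The odd part of a preimage of -1 acts as a sign of odd order, hence trivially, so the 2-part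
    acts as -1. Conjugating it into T does not change a scalar action. *)
Lemma exists_central_inversion : exists2 tau, tau \in T & rST tau = (-1)%:M.
Proof.
have [|h Sh eh] := phi_SL2 (A := (-1)%:M); first by rewrite det_scalar sqrrN expr1n.
have K1h : h \in pm1_set by apply/pm1_setP; split=> //; exists true.
have K1c pi : (h.`_pi)%g \in pm1_set by rewrite groupX.
have [S2 [b eb]] := pm1_setP _ (K1c 2%N^').
have [S1 [c ec]] := pm1_setP _ (K1c 2%N).
have b0 : b = false.
  apply/negP=> bT; rewrite bT expr1 in eb; case/eqP: N1_neq1.
  have o2 : odd #[h.`_(2%N^')]%g by have := p_elt_constt 2%N^' h; rewrite /p_elt -odd_2'nat.
  have eX k : rST ((h.`_(2%N^')) ^+ k)%g = ((-1) ^+ k)%:M.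
    elim: k => [|k IHk]; first by rewrite rST1.
    by rewrite expgS (rSTM S2 (groupX _ S2)) IHk eb -scalar_mxM exprS.
  by have := eX #[h.`_(2%N^')]%g; rewrite expg_order rST1 -signr_odd o2 expr1.
have cT : c = true.
  move: eh; rewrite -[h in rST h](consttC 2%N) (rSTM S1 S2) ec eb b0 expr0 mulmx1.
  by case: c {ec} => // e; case/eqP: N1_neq1; rewrite -e expr0.
have sK : <[h.`_2]>%g \subset pm1_set by rewrite cycle_subG.
have p2 : (2.-group <[h.`_2]>)%g by apply: p_elt_constt.
have [g K1g sg] := Sylow_Jsub sylT sK p2.
have Sg : g \in ST by have /pm1_setP[] := K1g.
exists ((h.`_2) ^ g)%g; last by apply: (rST_scalarJ Sg S1); rewrite ec cT expr1.
by rewrite -cycle_subG cycleJ.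
Qed.

Local Notation NT := ('N_ST(T))%g.

(** The factor of h in [pm1_set] acts as 1 or -1, and in the latter case it is replaced by the
    inversion tau, which lies in T and so normalises T. *)
Lemma phi_SL2N (A : 'M['F_p]_2) : \det A = 1 -> exists2 h, h \in NT & rST h = A.
Proof.
case/phi_SL2=> h Sh eA; have [tau Ttau etau] := exists_central_inversion.
have : h \in (pm1_set * NT)%g by rewrite (Frattini_arg pm1_normal sylT).
case/mulsgP=> k n K1k Nn def_h; have [Sn _] := setIP Nn.
have [Sk [[] ek]] := pm1_setP _ K1k; last first.
  exists n; first exact: Nn.
  by rewrite -eA def_h (rSTM Sk Sn) ek expr0 mul1mx.
exists (tau * n)%g; first by rewrite groupM // inE (subsetP sTS) // (subsetP (normG T)).
by rewrite -eA def_h (rSTM Sk Sn) (rSTM (subsetP sTS _ Ttau) Sn) ek etau expr1.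
Qed.

Lemma plane_NT_TI : (plane :&: NT = 1)%g.
Proof.
apply/trivgP/subsetP=> e /setIP[E0e /setIP[Se NTe]]; have [Ee _] := planeP _ E0e.
have [tau Ttau etau] := exists_central_inversion; have Stau := subsetP sTS _ Ttau.
have tiET : (E :&: T = 1)%g.
  apply: coprime_TIg; apply: pnat_coprime (abelem_pgroup abelE) _.
  apply: sub_in_pnat (pHall_pgroup sylT) => q _; rewrite !inE => /eqP ->.
  by rewrite eq_sym neq_ltn p_gt2 orbT.
(* E is normal in G and e normalises T, so e commutes with tau, which inverts it. *)
have : [~ e, tau]%g \in (E :&: T)%g.
  rewrite inE {1}commgEl groupM ?groupV //=; last first.
    by rewrite memJ_norm // (subsetP nEG) // (subsetP ST_subG).
  by rewrite commgEr groupM // memJ_norm ?groupV.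
rewrite tiET inE => /conjg_fixP fixe.
have := plane_coordJ E0e Stau; rewrite fixe etau -scalemx1 -scalemxAr mulmx1 scaleN1r => /eqP.
rewrite -subr_eq0 opprK -mulr2n -scaler_nat scaler_eq0 (negPf Fp_two_neq0) /= => /eqP c0.
apply/set1P; have := plane_coordK E0e; rewrite c0 mul0mx => e0.
by apply: (abelem_rV_inj (abelE := abelE) (ntE := ntE) Ee (group1 E)); rewrite abelem_rV_1.
Qed.

Local Notation to := ('MR (SL2_natural_repr p))%gact.

Definition plane_Qd e : Qd p := sdpair1 to (plane_coord e).
Definition NT_Qd h : Qd p := sdpair2 to (phi h).

Lemma plane_QdM : {in plane &, {morph plane_Qd : x y / (x * y)%g}}.
Proof.
move=> x y /planeP[Ex _] /planeP[Ey _]; rewrite /plane_Qd -sdpair1_morphM ?inE //; congr (sdpair1 _ _).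
by rewrite /plane_coord /rV abelem_rV_M // mulmxDl.
Qed.
Canonical plane_Qd_morphism := Morphism plane_QdM.

Lemma NT_QdM : {in NT &, {morph NT_Qd : x y / (x * y)%g}}.
Proof.
move=> x y /setIP[Sx _] /setIP[Sy _]; rewrite /NT_Qd -sdpair2_morphM ?phi_in_SL2 //.
by congr (sdpair2 _ _); apply: reprGLmM.
Qed.
Canonical NT_Qd_morphism := Morphism NT_QdM.

Lemma plane_NT_act : {in plane & NT, morph_act 'J 'J plane_Qd NT_Qd}.
Proof.
move=> e h E0e /setIP[Sh _]; rewrite /= /plane_Qd /NT_Qd plane_coordJ //.
have <- : (to (plane_coord e) (phi h))%act = plane_coord e *m rST h.
  rewrite /= mx_repr_actE ?phi_in_SL2 //.
  by congr (_ *m _); apply: (val_reprGLm rST).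
by apply: sdpair_act; [rewrite inE | apply: phi_in_SL2].
Qed.

Lemma Sylow_normalizer_Qd : ~ Qd_free p G.
Proof.
have nE0N : NT \subset 'N(plane)%g by rewrite subIset // ST_norm_plane.
have defH := sdprodEY nE0N plane_NT_TI.
pose f := sdprodm defH plane_NT_act.
have im_f : (f @* (plane <*> NT) = [set: Qd p])%g.
  rewrite im_sdprodm; apply/eqP; rewrite -subTset -(im_sdpair to) mulgSS //.
    apply/subsetP=> _ /morphimP[c _ _ ->]; pose e := Vr (c *m Bf).
    have E0e : e \in plane.
      by apply/planeP; rewrite /e mem_rVabelem /rV rVabelemK submxMl.
    apply/morphimP; exists e => //; rewrite /= /plane_Qd /plane_coord /e /rV rVabelemK.
    by rewrite mulmxKp // free_v12.
  apply/subsetP=> _ /morphimP[g _ SLg ->].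
  have /eqP dg : \det (GLval g) == 1 by move: SLg; rewrite inE.
  have [h Nh eh] := phi_SL2N dg; apply/morphimP; exists h => //=; rewrite /NT_Qd.
  congr (sdpair2 _ _); apply: val_inj; rewrite /= -eh.
  by rewrite -(val_reprGLm rST) //; have /setIP[] := Nh.
move=> frG; apply: (frG ('ker f)%G (plane <*> NT)%G); first exact: ker_normal.
  rewrite join_subG [NT \subset G]subIset ?ST_subG // andbT.
  by apply: subset_trans (normal_sub nsEG); apply/subsetP=> e /planeP[].
by rewrite -im_f; apply: first_isog.
Qed.

End SylowNormalizer.

Lemma Qd_section : ~ Qd_free p G.
Proof. by have [T sylT] := Sylow_exists 2%N pm1_group; apply: Sylow_normalizer_Qd sylT. Qed.

End QdSection.

(** * Pairs of quadratic elements *)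

Section TwoQuadratic.

Import GRing.Theory.
Local Open Scope ring_scope.

Variables (p : nat) (F : fieldType) (gT : finGroupType) (G : {group gT}) (n' : nat).
Local Notation n := n'.+1.
Variable rG : mx_representation F G n.
Hypothesis chF : p \in [pchar F].
Variables x y : gT.
Hypotheses (Gx : x \in G) (Gy : y \in G).

Local Notation X := (rG x - 1).
Local Notation Y := (rG y - 1).
Hypotheses (XX : X * X = 0) (YY : Y * Y = 0).

(* Since X ^ 2 = Y ^ 2 = 0, the row spaces of the two alternating products of k
   factors X and Y span a descending filtration whose factors x and y centralise. *)
Fixpoint altX k : 'M[F]_n * 'M[F]_n :=
  if k is k'.+1 then ((altX k').2 * X, (altX k').1 * Y) else (1, 1).

Definition alt_sum k := ((altX k).1 + (altX k).2)%MS.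

Lemma alt_sumX k : (alt_sum k *m X <= alt_sum k.+1)%MS.
Proof.
rewrite addsmxMr addsmx_sub; apply/andP; split; last exact: addsmxSl.
case: k => [|k]; first exact: addsmxSl.
by rewrite [(altX _).1]/= mulmxE -mulrA XX mulr0 sub0mx.
Qed.

Lemma alt_sumY k : (alt_sum k *m Y <= alt_sum k.+1)%MS.
Proof.
rewrite addsmxMr addsmx_sub; apply/andP; split; first exact: addsmxSr.
case: k => [|k]; first exact: addsmxSr.
by rewrite [(altX _).2]/= mulmxE -mulrA YY mulr0 sub0mx.
Qed.

Lemma alt_sumS k : (alt_sum k.+1 <= alt_sum k)%MS.
Proof.
elim: k => [|k IHk].
  apply: submx_trans (submx1 _) _; exact: addsmxSl.
rewrite addsmx_sub; apply/andP; split.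
  by apply: submx_trans (alt_sumX k); apply: submxMr; apply: submx_trans IHk; apply: addsmxSr.
by apply: submx_trans (alt_sumY k); apply: submxMr; apply: submx_trans IHk; apply: addsmxSl.
Qed.

Lemma altX_even k : altX k.*2 = ((Y * X) ^+ k, (X * Y) ^+ k).
Proof. by elim: k => // k IHk; rewrite doubleS /= IHk /= !exprSr !mulrA. Qed.

(** The bound on k makes the condition boolean; it is large enough to reach [alt_sum n.+1.*2], which
    vanishes when (X * Y) ^+ n = 0. *)
Definition stab_alt :=
  [set h in G | [forall k : 'I_(4 * n).+1, (alt_sum k *m (rG h - 1) <= alt_sum k.+1)%MS]].

Lemma stab_altP h : reflect
  (h \in G /\ forall k : nat, (k <= 4 * n)%N -> (alt_sum k *m (rG h - 1) <= alt_sum k.+1)%MS)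
  (h \in stab_alt).
Proof.
rewrite inE; apply: (iffP andP) => -[-> sh]; split=> //.
  by move=> k; rewrite -ltnS => lt_k; apply: (forallP sh (Ordinal lt_k)).
by apply/forallP=> k; apply: sh; rewrite -ltnS.
Qed.

Lemma stab_alt_group_set : group_set stab_alt.
Proof.
apply/group_setP; split=> [|g h /stab_altP[Gg sg] /stab_altP[Gh sh]].
  by apply/stab_altP; split=> // k _; rewrite repr_mx1 subrr mulmx0 sub0mx.
apply/stab_altP; split=> [|k lek]; first exact: groupM.
rewrite repr_mxM // (_ : _ *m _ - 1 = (rG g - 1) *m (rG h - 1) + (rG g - 1) + (rG h - 1)); last first.
  by rewrite !mulmxE mulrBr mulr1 mulrBl mul1r subrK addrA subrK.
move: (rG g - 1) (rG h - 1) sg sh => A B sg sh.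
rewrite 2!mulmxDr; apply: addmx_sub (sh k lek); apply: addmx_sub (sg k lek).
rewrite mulmxA.
apply: submx_trans (sh k lek); apply: submxMr; exact: submx_trans (sg k lek) (alt_sumS k).
Qed.
Canonical stab_alt_group := Group stab_alt_group_set.

Lemma quadratic_gen_unipotent h : (X * Y) ^+ n = 0 -> h \in <<[set x; y]>>%g ->
  exists e, rG (h ^+ (p ^ e))%g = 1.
Proof.
move=> XYn Hh.
have /stab_altP[Gh sh] : h \in stab_alt.
  apply: subsetP Hh; rewrite gen_subG; apply/subsetP=> z /set2P[] ->; apply/stab_altP; split=> // k _.
    exact: alt_sumX.
  exact: alt_sumY.
have sub k : (k <= (4 * n).+1)%N -> ((rG h - 1) ^+ k <= alt_sum k)%MS.
  elim: k => [|k IHk] lek; first by rewrite expr0; apply: addsmxSl.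
  rewrite exprSr; apply: submx_trans (sh k lek); apply: submxMr; exact: IHk (ltnW lek).
(* The exponent is n + 1 because (Y X)^(n+1) = Y (X Y)^n X. *)
have alt0 : alt_sum n.+1.*2 = 0.
  apply/eqP; rewrite -submx0 addsmx_sub altX_even /= !submx0.
  rewrite [in X in _ && X]exprS XYn mulr0 eqxx andbT.
  have YXE k : (Y * X) ^+ k.+1 = Y * (X * Y) ^+ k * X.
    by elim: k => [|k IHk]; [rewrite expr0 mulr1 expr1 | rewrite exprS IHk [in RHS]exprS !mulrA].
  by rewrite YXE XYn mulr0 mul0r.
have nil : (rG h - 1) ^+ n.+1.*2 = 0.
  by apply/eqP; rewrite -submx0 -alt0 sub //; lia.
exists n.+1.*2.
have chM : p \in [pchar 'M[F]_n] by rewrite pchar_lalg.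
(* Frobenius on commuting matrices, used with p ^ e at least the nilpotency exponent. *)
have frob e : rG h ^+ (p ^ e) = 1 + (rG h - 1) ^+ (p ^ e).
  elim: e => [|e IHe]; first by rewrite !expr1 addrC subrK.
  rewrite expnSr !exprM IHe -!(pFrobenius_autE chM) pFrobenius_autD_comm ?pFrobenius_aut1 //.
  exact: commr_sym (commr1 _).
rewrite repr_mxX // frob; have /subnK <- : (n.+1.*2 <= p ^ n.+1.*2)%N.
  by apply/ltnW/ltn_expl/prime_gt1/(pcharf_prime chF).
by rewrite exprD nil mulr0 addr0.
Qed.

End TwoQuadratic.

(** * From a splitting field back to the prime field *)

Section Extension.

Import GRing.Theory.
Local Open Scope ring_scope.

Variables (p : nat) (gT : finGroupType) (G : {group gT}) (n' : nat).
Local Notation n := n'.+1.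
Variable rG : mx_representation 'F_p G n.
Hypotheses (p_pr : prime p) (p_gt2 : (2 < p)%N).
Variables x y : gT.
Hypotheses (Gx : x \in G) (Gy : y \in G).
Hypotheses (XX : (rG x - 1) * (rG x - 1) = 0) (YY : (rG y - 1) * (rG y - 1) = 0).
Hypothesis XYn : ((rG x - 1) * (rG y - 1)) ^+ n != 0.

Variables (F : finFieldType) (iota : {rmorphism 'F_p -> F}).
(* The F_p-linear forms on F separate points. *)
Hypothesis coord_sep : forall z : F, z != 0 -> exists l : F -> 'F_p,
  [/\ {morph l : a b / a + b}, forall a b, l (iota a * b) = a * l b & l z != 0].
Hypothesis split_char : exists rs : seq F,
  char_poly (map_mx iota ((rG x - 1) * (rG y - 1))) %= \prod_(z <- rs) ('X - z%:P).
Hypothesis split_unity : exists rs : seq F,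
  'X^#|G| - 1 %= \prod_(z <- rs) ('X - z%:P).

Local Notation rF := (map_repr iota rG).

Let chF : p \in [pchar F].
Proof. by rewrite (fmorph_pchar iota) pchar_Fp. Qed.

(** If all roots of the split characteristic polynomial were zero, Cayley-Hamilton would contradict
    [XYn]. *)
Lemma exists_eigenvector : exists2 mu : F, mu != 0 &
  exists2 v : 'rV_n, v != 0 & v *m ((rF x - 1) *m (rF y - 1)) = mu *: v.
Proof.
have defXY : map_mx iota ((rG x - 1) * (rG y - 1)) = (rF x - 1) *m (rF y - 1).
  by rewrite map_mxM !map_mxB map_mx1.
have [rs eq_rs] := split_char.
have [z rs_z nz] : exists2 z, z \in rs & z != 0.
  apply/hasP; apply: contraR XYn => /hasPn rs0.
  have eqX : char_poly (map_mx iota ((rG x - 1) * (rG y - 1))) = 'X^n.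
    have prX : \prod_(z <- rs) ('X - z%:P) = 'X^(size rs) :> {poly F}.
      rewrite (eq_big_seq (fun=> 'X)) => [|z /rs0]; last by rewrite negbK => /eqP->; rewrite subr0.
      by rewrite big_const_seq count_predT iter_mulr_1.
    have := eq_rs; rewrite prX eqp_monic ?char_poly_monic ?monicXn // => /eqP e.
    move: (congr1 (fun q : {poly F} => size q) e); rewrite size_char_poly size_polyXn => -[en].
    by rewrite e -en.
  have := Cayley_Hamilton (map_mx iota ((rG x - 1) * (rG y - 1))).
  rewrite eqX rmorphXn /= horner_mx_X -rmorphXn => /eqP; rewrite map_mx_eq0 //.
have : eigenvalue (map_mx iota ((rG x - 1) * (rG y - 1))) z.
  by rewrite eigenvalue_root_char (eqp_root eq_rs) root_prod_XsubC.
case/eigenvalueP=> v ev nv; exists z => //; exists v => //.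
by rewrite -defXY.
Qed.

(** The minimal polynomial divides X^|G| - 1, which splits over F. Applied to the action on a plane,
    this gives each group element an eigenvector in F^2. *)
Lemma split_unity_eigen m (M : 'M[F]_m.+1) : M ^+ #|G| = 1 ->
  exists2 a : F, a != 0 & exists2 u : 'rV_m.+1, u != 0 & u *m M = a *: u.
Proof.
move=> MG; have [rs eq_rs] := split_unity.
have : mxminpoly M %| \prod_(z <- rs) ('X - z%:P).
  rewrite -(eqp_dvdr _ eq_rs) mxminpoly_min // rmorphB rmorphXn rmorph1 /= horner_mx_X.
  by rewrite MG subrr.
case/dvdp_prod_XsubC=> ms eq_min.
have : exists z, root (mxminpoly M) z.
  case: (mask ms rs) eq_min => [|z r] eqm; last first.
    by exists z; rewrite (eqp_root eqm) root_prod_XsubC mem_head.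
  have := mxminpoly_nonconstant M; rewrite -ltnS -size_mxminpoly (eqp_size eqm) big_nil size_poly1 //.
case=> z; rewrite -eigenvalue_root_min => /eigenvalueP[u eu nu].
exists z; last by exists u.
have eX k : u *m M ^+ k = z ^+ k *: u.
  elim: k => [|k IHk]; first by rewrite !expr0 mulmx1 scale1r.
  by rewrite exprSr -mulmxE mulmxA IHk -scalemxAl eu scalerA exprSr.
apply: contraNneq nu => z0; have := eX #|G|; rewrite MG mulmx1 z0 => ->.
by rewrite expr0n (gtn_eqF (cardG_gt0 G)) scale0r.
Qed.

Section Pair.

Variables (mu : F) (v : 'rV[F]_n).
Hypotheses (nmu : mu != 0) (nv : v != 0).
Hypothesis ev : v *m ((rF x - 1) *m (rF y - 1)) = mu *: v.

Local Notation w := (v *m (rF x - 1)).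

Let rF1E z : rF z - 1 = map_mx iota (rG z - 1).
Proof. by rewrite map_mxB map_mx1. Qed.

Let XXF : (rF x - 1) *m (rF x - 1) = 0.
Proof. by rewrite rF1E -map_mxM mulmxE XX map_mx0. Qed.

Let YYF : (rF y - 1) *m (rF y - 1) = 0.
Proof. by rewrite rF1E -map_mxM mulmxE YY map_mx0. Qed.

Let wX : w *m (rF x - 1) = 0. Proof. by rewrite -mulmxA XXF mulmx0. Qed.
Let wY : w *m (rF y - 1) = mu *: v. Proof. by rewrite -mulmxA ev. Qed.

Let vY : v *m (rF y - 1) = 0.
Proof.
apply: (scalerI nmu); rewrite scaler0 scalemxAl -wY -(mulmxA w) YYF mulmx0 //.
Qed.

Let nw : w != 0.
Proof.
apply/eqP=> w0; have /eqP := wY; rewrite w0 mul0mx eq_sym scaler_eq0.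
by rewrite (negPf nmu) (negPf nv).
Qed.

Let subK1 (u : 'rV[F]_n) (A : 'M[F]_n) : u *m A = u *m (A - 1) + u.
Proof. by rewrite mulmxBr mulmx1 subrK. Qed.

Let vx : v *m rF x = 1 *: v + 1 *: w.
Proof. by rewrite subK1 addrC !scale1r. Qed.
Let wx : w *m rF x = 0 *: v + 1 *: w.
Proof. by rewrite subK1 wX scale1r scale0r. Qed.
Let vy : v *m rF y = 1 *: v + 0 *: w.
Proof. by rewrite subK1 vY scale1r scale0r addrC. Qed.
Let wy : w *m rF y = mu *: v + 1 *: w.
Proof. by rewrite subK1 wY scale1r. Qed.

Local Notation Bf := (frame2 v w).

Lemma free_vw : row_free Bf.
Proof.
apply: free_frame2 => a b e0; have a0 : a = 0.
  have : (a *: v + b *: w) *m (rF x - 1) = 0 by rewrite e0 mul0mx.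
  rewrite mulmxDl -!scalemxAl wX scaler0 addr0 => /eqP.
  by rewrite scaler_eq0 (negPf nw) orbF => /eqP.
by move/eqP: e0; rewrite a0 scale0r add0r scaler_eq0 (negPf nw) orbF => /eqP->.
Qed.

Local Notation Rs := (rstabs rF Bf).
Local Notation rR := (frame_repr rF free_vw).

Let RsP z : z \in Rs -> z \in G.
Proof. by move=> Rz; apply: subsetP Rz; apply: rstabs_sub. Qed.

Let Rx : x \in Rs /\ rR x = mx2 1 1 0 1.
Proof.
have e := mx2_frame vx wx; split; first exact: frame_stab Gx e.
refine (frame_mx_eq free_vw e).
Qed.

Let Ry : y \in Rs /\ rR y = mx2 1 0 mu 1.
Proof.
have e := mx2_frame vy wy; split; first exact: frame_stab Gy e.
refine (frame_mx_eq free_vw e).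
Qed.

Let rRM g h : g \in Rs -> h \in Rs -> rR (g * h)%g = rR g *m rR h.
Proof. exact: (repr_mxM rR). Qed.

Let rR1 : rR 1%g = 1%:M.
Proof. exact: (repr_mx1 rR). Qed.

Let rRK (u : 'rV[F]_2) h : h \in Rs -> (u *m Bf) *m rF h = (u *m rR h) *m Bf.
Proof. by move=> Rh; rewrite -mulmxA -(frame_mxK Rh) mulmxA. Qed.

Definition frame_GL2 : {set GL2 F} :=
  [set g | [exists h in Rs, [exists a, (a != 0) && (mx g == a *: rR h)]]].

Lemma frame_GL2P g : reflect
  (exists2 h, h \in Rs & exists2 a, a != 0 & mx g = a *: rR h) (g \in frame_GL2).
Proof.
rewrite in_set; apply: (iffP exists_inP) => -[h Rh].
  by case/existsP=> a /andP[na /eqP e]; exists h => //; exists a.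
by case=> a na e; exists h => //; apply/existsP; exists a; rewrite na e eqxx.
Qed.

Lemma frame_GL2_group_set : group_set frame_GL2.
Proof.
apply/group_setP; split=> [|g g' /frame_GL2P[h Rh [a na e]] /frame_GL2P[h' Rh' [a' na' e']]].
  by apply/frame_GL2P; exists 1%g; [exact: group1 | exists 1; rewrite ?oner_neq0 // scale1r rR1].
apply/frame_GL2P; exists (h * h')%g; first exact: groupM.
by exists (a * a'); rewrite ?mulf_neq0 // mxM e e' rRM // -scalemxAl -scalemxAr scalerA.
Qed.
Canonical frame_GL2_group := Group frame_GL2_group_set.

(** A scalar factor a multiplies both the square of the entry and the determinant by a^2, so the
    element found modulo scalars can be taken in [Rs]. *)
Lemma frame_rational_entry : exists2 h, h \in Rs &
  exists2 j : nat, (rR h 1 0) ^+ 2 * j%:R = \det (rR h) & rR h 1 0 != 0.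
Proof.
have sSc : scalars F \subset frame_GL2_group.
  apply/subsetP=> _ /scalarsP[a na ->]; apply/frame_GL2P; exists 1%g; first exact: group1.
  exists a => //; rewrite rR1 scalemx1 scalar_mx2 scalE //.
have uG : Utr (1 : F) \in frame_GL2_group.
  have [Rx' ex] := Rx; apply/frame_GL2P; exists x => //; exists 1; rewrite ?oner_neq0 //.
  by rewrite scale1r ex UtrE.
have eigG g : g \in frame_GL2_group -> exists2 u : F * F, u != 0 & eigv g u.
  case/frame_GL2P=> h Rh [a na eg].
  have [|b nb [u nu eu]] := @split_unity_eigen 1 (rR h).
    have := repr_mxX rR #|G| Rh; rewrite expg_cardG ?RsP // => <-; exact: rR1.
  exists (u 0 0, u 0 1); first by rewrite pair_eq0 -rv2_eq0 -rv2_eta.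
  apply/eigvP; first by rewrite pair_eq0 -rv2_eq0 -rv2_eta.
  exists (a * b); first by rewrite mulf_neq0.
  have : u *m mx g = (a * b) *: u by rewrite eg -scalemxAr eu scalerA.
  rewrite [u]rv2_eta [mx g]mx2_eta mul_rv2 scale_rv2 => /rv2_inj[e1 e2].
  by rewrite !rv2E /pact /sc /=; congr (_, _); [exact: e1 | exact: e2].
have movG : exists2 g, g \in frame_GL2_group & mx g 1 0 != 0.
  have [Ry' ey] := Ry; have dn : 1 * 1 - 0 * mu != 0 :> F by rewrite mul0r subr0 mulr1 oner_neq0.
  exists (mkGL 1 0 mu 1); last by rewrite mkGLE // mx2E.
  by apply/frame_GL2P; exists y => //; exists 1; rewrite ?oner_neq0 // scale1r ey mkGLE.
have [g /frame_GL2P[h Rh [a na eg]] [j]] := dickson_rational_entry p_pr p_gt2 chF sSc uG movG eigG.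
have g10 : mx g 1 0 = a * rR h 1 0 by rewrite eg mxE.
rewrite gdetE g10 eg detZ exprMn -mulrA => /(mulfI (expf_neq0 2 na)) ej.
exists h => //; exists j => //; apply/eqP=> h0; move: ej; rewrite h0 expr0n mul0r => /esym/eqP.
apply/negP; rewrite -unitfE -unitmxE; exact: (repr_mx_unit rR).
Qed.

(** The element x fixes w, and t0 = x^h fixes V2 = w h. With k = h_21, x sends V2 to V2 + k w, which
    is why V1 = k w. Then t0 subtracts (k^2 / det h) V2 from V1, and a power of t0 turns this
    coefficient into +1. *)
Lemma row_pair : exists s t : gT, exists V1 V2 : 'rV[F]_n,
  [/\ s \in G, t \in G & V1 != 0] /\
  [/\ V1 *m rF s = V1, V2 *m rF s = V2 + V1, V1 *m rF t = V1 + V2 & V2 *m rF t = V2].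
Proof.
have [h Rh [j ej nk]] := frame_rational_entry; have Gh := RsP Rh.
have [Rx' ex] := Rx.
set M := rR h in ej nk; set k := M 1 0 in ej nk.
pose t0 := (x ^ h)%g; have Rt0 : t0 \in Rs by apply: groupJ.
have dM : \det M != 0 by rewrite -unitfE -unitmxE; apply: (repr_mx_unit rR).
have wE : w = rv2 0 1 *m Bf by rewrite rv2_frame scale0r add0r scale1r.
pose V1 := k *: w; pose V2 := w *m rF h.
have V2E : V2 = rv2 k (M 1 1) *m Bf.
  by rewrite /V2 {1}wE rRK // -/M [M]mx2_eta mul_rv2 !mx2E !mul0r !mul1r !add0r.
have hx : (h * t0 = x * h)%g by rewrite /t0 -conjgC.
have V2t0 : V2 *m rF t0 = V2.
  rewrite /V2 -mulmxA -repr_mxM ?RsP // hx repr_mxM // mulmxA wx.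
  by rewrite scale0r add0r scale1r.
have wt0 : w *m rF t0 = w - (k / \det M) *: V2.
  have -> : w = (rv2 (- k / \det M) (M 0 0 / \det M) *m M) *m Bf.
    rewrite {1}wE; congr (_ *m _); move: dM; rewrite [M]mx2_eta det_mx2 !mx2E -/k => dM.
    by rewrite mul_rv2; congr (rv2 _ _); field.
  rewrite -{1}(rRK _ Rh) -mulmxA -repr_mxM ?RsP // hx rRK ?groupM // rRM // ex -/M V2E.
  rewrite scalemxAl -mulmxBl; congr (_ *m _).
  move: dM; rewrite [M]mx2_eta det_mx2 !mx2E -/k => dM.
  rewrite mul_mx2 !mul_rv2 scale_rv2.
  move: (M 0 0) (M 0 1) (M 1 1) dM => m00 m01 m11 dM.
  by apply: eq_rv2; rewrite !mxE /=; field.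
have V1t0 i : V1 *m rF (t0 ^+ i)%g = V1 - (i%:R * (k ^+ 2 / \det M)) *: V2.
  elim: i => [|i IHi]; first by rewrite repr_mx1 mulmx1 mul0r scale0r subr0.
  rewrite expgSr repr_mxM ?groupX ?RsP // mulmxA IHi mulmxBl -!scalemxAl wt0 V2t0.
  rewrite scalerBr scalerA -/V1 -addrA -opprD -scalerDl -natr1; congr (_ - _ *: _).
  by ring.
(* Chosen so that i * (k ^ 2 / det M) = -1. *)
pose i := (j * p.-1)%N.
have V2t : V2 *m rF (t0 ^+ i)%g = V2.
  elim: i => [|l IHl]; first by rewrite repr_mx1 mulmx1.
  by rewrite expgSr repr_mxM ?groupX ?RsP // mulmxA IHl V2t0.
exists x, (t0 ^+ i)%g, V1, V2; split; first split=> //.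
- by rewrite groupX // RsP.
- by rewrite scaler_eq0 negb_or nk.
split=> //.
- by rewrite /V1 -scalemxAl wx scale0r add0r scale1r.
- rewrite V2E (rRK _ Rx') ex mul_rv2 !mulr1 mulr0 addr0.
  rewrite !rv2_frame -addrA; congr (_ + _).
  by rewrite /V1 -scalerDl addrC.
rewrite V1t0 (_ : i%:R * _ = -1) ?scaleN1r ?opprK //.
rewrite -ej in dM *; have [_ nj] : k ^+ 2 != 0 /\ j%:R != 0 :> F.
  by apply/andP; rewrite -negb_or -mulf_eq0.
have p1 : p.-1%:R = -1 :> F.
  by apply/eqP; rewrite -subr_eq0 opprK natr1 prednK ?prime_gt0 // (pcharf0 chF).
by rewrite /i natrM p1; field; rewrite nj nk.
Qed.

End Pair.

(** An F_p-linear form applied to all coordinates commutes with matrices over F_p. It is chosen to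
    keep V1 nonzero; the independence of the two images then follows from the relations with s and
    t, as in [free_v12]. *)
Lemma quadratic_pair : exists s t : gT, exists v1 v2 : 'rV['F_p]_n,
  [/\ s \in G, t \in G & v1 != 0] /\
  [/\ v1 *m rG s = v1, v2 *m rG s = v2 + v1, v1 *m rG t = v1 + v2 & v2 *m rG t = v2].
Proof.
have [mu nmu [v nv ev]] := exists_eigenvector.
have [s [t [V1 [V2 [[Gs Gt nV1] [s1 s2 t1 t2]]]]]] := row_pair nmu nv ev.
have [c nc] : exists c, V1 0 c != 0.
  apply/existsP; apply: contraR nV1; rewrite negb_exists => /forallP V0.
  by apply/eqP/rowP=> c; rewrite mxE; apply/eqP; have := V0 c; rewrite negbK.
have [l [lD lZ nl]] := coord_sep nc.
have l0 : l 0 = 0 by apply: (addrI (l 0)); rewrite -lD !addr0.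
have lM (V : 'rV[F]_n) (A : 'M['F_p]_n) : map_mx l (V *m map_mx iota A) = map_mx l V *m A.
  apply/rowP=> i; rewrite !mxE.
  rewrite (big_morph l lD l0); apply: eq_bigr => k _.
  by rewrite !mxE mulrC lZ mulrC.
have lA (V W : 'rV[F]_n) : map_mx l (V + W) = map_mx l V + map_mx l W.
  by apply/rowP=> i; rewrite !mxE lD.
exists s, t, (map_mx l V1), (map_mx l V2); split.
  split=> //; apply: contraNneq nl => /rowP/(_ c); rewrite !mxE => ->; exact: eqxx.
by split; rewrite -lM ?s1 ?s2 ?t1 ?t2 ?lA.
Qed.

End Extension.

Section SplitField.

Import GRing.Theory.
Local Open Scope ring_scope.

Variables (p : nat) (q : {poly 'F_p}).
Hypotheses (p_pr : prime p) (nq : q != 0).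

Lemma splitting_extension : exists F : finFieldType, exists iota : {rmorphism 'F_p -> F},
  (forall z : F, z != 0 -> exists l : F -> 'F_p,
    [/\ {morph l : a b / a + b}, forall a b, l (iota a * b) = a * l b & l z != 0])
  /\ exists rs : seq F, map_poly iota q %= \prod_(z <- rs) ('X - z%:P).
Proof.
have [L [rs eq_rs _]] := FinSplittingFieldFor nq.
pose F : finFieldType := finvect_type L.
exists F, (in_alg L); split; last by exists rs.
move=> z nz; pose b := vbasis {:L}.
have [i ni] : exists i, coord b i z != 0.
  apply/existsP; apply: contraR nz; rewrite negb_exists => /forallP c0.
  rewrite (coord_vbasis (memvf z)) big1 // => i _.
  by have := c0 i; rewrite negbK => /eqP ->; rewrite scale0r.
exists (coord b i); split=> // [u v | a u]; first exact: linearD.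
transitivity (coord b i (a *: (u : L))); last by rewrite linearZ.
by congr (coord b i _); apply: (mulr_algl a (u : L)).
Qed.

End SplitField.

Section PairOup.

Import GRing.Theory.
Local Open Scope ring_scope.

Variables (p : nat) (gT : finGroupType) (G E : {group gT}).
Hypotheses (p_pr : prime p) (p_gt2 : (2 < p)%N) (frG : Qd_free p G).
Hypotheses (nsEG : (E <| G)%g) (abelE : p.-abelem%g E).

Let nEG : G \subset 'N(E)%g := normal_norm nsEG.

Lemma quadratic_repr (ntE : E :!=: 1%g) x : x \in G ->
  (forall e, e \in E -> [~ e, x, x] = 1)%g ->
  (abelem_repr abelE ntE nEG x - 1) * (abelem_repr abelE ntE nEG x - 1) = 0.
Proof.
move=> Gx qx; set rG := abelem_repr abelE ntE nEG.
have eX e : e \in E -> abelem_rV abelE ntE [~ e, x]%g = abelem_rV abelE ntE e *m (rG x - 1).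
  move=> Ee; have Eex : (e ^ x)%g \in E by rewrite memJ_norm // (subsetP nEG).
  rewrite commgEl abelem_rV_M ?groupV // abelem_rV_V // (abelem_rV_J _ _ nEG) //.
  by rewrite mulmxBr mulmx1 addrC.
apply/row_matrixP=> i; rewrite row0 -mulmxE rowE mulmxA.
rewrite -[delta_mx 0 i](rVabelemK abelE ntE).
have Ee := mem_rVabelem abelE ntE (delta_mx 0 i); rewrite -eX // -eX ?qx ?abelem_rV_1 //.
by rewrite commgEl groupM ?groupV // memJ_norm // (subsetP nEG).
Qed.

Lemma quadratic_pair_cent x y : x \in G -> y \in G ->
    (forall e, e \in E -> [~ e, x, x] = 1)%g -> (forall e, e \in E -> [~ e, y, y] = 1)%g ->
  Oup p <<[set x; y]>>%G \subset 'C(E)%g.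
Proof.
move=> Gx Gy qx qy; case: (eqsVneq E 1%g) => [-> | ntE]; first by rewrite cent1T subsetT.
pose rG := abelem_repr abelE ntE nEG.
have XX : (rG x - 1) * (rG x - 1) = 0 := quadratic_repr ntE Gx qx.
have YY : (rG y - 1) * (rG y - 1) = 0 := quadratic_repr ntE Gy qy.
have sHG : <<[set x; y]>>%g \subset G by rewrite gen_subG; apply/subsetP=> z /set2P[] ->.
have chp := pchar_Fp p_pr.
have [XYn | nXYn] := eqVneq (((rG x - 1) * (rG y - 1)) ^+ (abelem_dim' (gval E)).+1) 0.
  apply/Oup_subP=> h Hh p'h; have Gh := subsetP sHG h Hh.
  have [k hk] := quadratic_gen_unipotent chp Gx Gy XX YY XYn Hh.
  have Chk : (h ^+ (p ^ k))%g \in 'C(E)%g.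
    have : (h ^+ (p ^ k))%g \in rker rG.
      by rewrite inE groupX //= hk mulmx1 eqxx.
    by rewrite rker_abelem => /setIP[].
  (* The order of h is prime to p. *)
  have [j ej] : exists j, (h = (h ^+ (p ^ k)) ^+ j)%g.
    have co : coprime #[h]%g (p ^ k).
      by rewrite coprime_sym (pnat_coprime _ p'h) // pnatX pnat_id.
    by exists (expg_invn <[h]>%g (p ^ k)); rewrite (expgK co) ?cycle_id.
  by rewrite ej groupX.
exfalso.
(* One splitting field then serves both the eigenvector of the product and the eigenvectors of the
   group elements. *)
pose q : {poly 'F_p} := char_poly ((rG x - 1) * (rG y - 1)) * ('X^#|G| - 1).
have mU : ('X^#|G| - 1 : {poly 'F_p}) \is monic by exact: (monicXnsubC 1 (cardG_gt0 G)).
have nq : q != 0 by rewrite mulf_neq0 ?monic_neq0 ?char_poly_monic.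
have [F [iota [csep [rs eq_rs]]]] := splitting_extension nq.
move: eq_rs; rewrite /q rmorphM /= => eq_rs.
have [s1 e1] := dvdp_prod_XsubC (etrans (esym (eqp_dvdr _ eq_rs)) (dvdp_mulr _ (dvdpp _))).
have [s2 e2] := dvdp_prod_XsubC (etrans (esym (eqp_dvdr _ eq_rs)) (dvdp_mull _ (dvdpp _))).
rewrite map_char_poly in e1; rewrite rmorphB rmorph1 /= map_polyXn in e2.
have [||s [t [v1 [v2 [[Gs Gt nv1] [es1 es2 et1 et2]]]]]] :=
   quadratic_pair p_pr p_gt2 Gx Gy XX YY nXYn csep.
- by exists (mask s1 rs).
- by exists (mask s2 rs).
exact: (Qd_section p_pr p_gt2 Gs Gt nv1 es1 es2 et1 et2 frG).
Qed.

End PairOup.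

(** * p-stability *)

Section PStable.

Variables (p : nat) (gT : finGroupType).
Hypotheses (p_pr : prime p) (p_gt2 : 2 < p).

Lemma Qd_free_quotient (G W : {group gT}) : W <| G -> Qd_free p G -> Qd_free p (G / W).
Proof.
move=> nsWG frG K H nsKH sHG isoQ.
have sHG' : coset W @*^-1 H \subset G by rewrite -(quotientGK nsWG) morphpreS.
have nsK' : coset W @*^-1 K <| coset W @*^-1 H by rewrite cosetpre_normal.
have sWK : W \subset coset W @*^-1 K by rewrite -{1}ker_coset kerE morphpreS ?sub1G.
have nsW : W <| coset W @*^-1 H.
  by rewrite (normalS _ sHG' nsWG) // (subset_trans sWK) ?normal_sub.
apply: (frG _ _ nsK' sHG'); apply: isog_trans isoQ.
have := third_isog sWK nsW nsK'; rewrite !cosetpreK => iso.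
by rewrite isog_sym.
Qed.

Lemma quadratic_conj (rT : finGroupType) (E : {group rT}) (x y : rT) : y \in 'N(E) ->
  (forall e, e \in E -> [~ e, x, x] = 1) -> forall e, e \in E -> [~ e, x ^ y, x ^ y] = 1.
Proof.
move=> nEy qx e Ee; have := qx (e ^ y^-1); rewrite memJ_norm ?groupV // => /(_ Ee).
by move/(congr1 (conjg^~ y)); rewrite !conjRg conjgKV conj1g.
Qed.

(** K is the preimage of O_p of G / W modulo the centraliser of U / W. By [quadratic_pair_cent] an
    element of A and any conjugate of it generate a p-group modulo this centraliser, so Baer-Suzuki
    puts A in K. *)
Theorem p_stable (G U W A : {group gT}) :
  Qd_free p G -> U <| G -> W <| G -> W \subset U -> p.-group U -> p.-abelem (U / W) ->
  A \subset G -> p.-group A -> [~: U, A, A] \subset W ->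
  exists2 K : {group gT}, K <| G /\ A \subset K & [~: U, Oup p K] \subset W.
Proof.
move=> frG nsU nsW sWU pU abE sAG pA qA.
have frGb := Qd_free_quotient nsW frG; have [sWG nWG] := andP nsW.
have [sUG nUG] := andP nsU; have nWU := subset_trans sUG nWG.
have nsE : U / W <| G / W by apply: quotient_normal.
have nEG := normal_norm nsE.
pose C := 'C_(G / W)(U / W)%G.
have nsC : C <| G / W by rewrite /normal subsetIl normsI ?normG ?norms_cent.
have nCG := normal_norm nsC.
pose R := (coset C @*^-1 'O_p(G / W / C))%G.
have nsR : R <| G / W by rewrite -(quotientGK nsC) cosetpre_normal pcore_normal.
pose K := (coset W @*^-1 R)%G; have nsK : K <| G by rewrite -(quotientGK nsW) cosetpre_normal.
have nCR := subset_trans (normal_sub nsR) nCG; have nWK := subset_trans (normal_sub nsK) nWG.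
exists K; last first.
  have sOC : Oup p R \subset C by rewrite Oup_sub_quo // cosetpreK pcore_pgroup.
  have sOK := subset_trans (Oup_sub p K) nWK.
  rewrite -quotient_cents2 // centsC; apply: subset_trans (subsetIr (G / W) _).
  apply: subset_trans sOC; rewrite sub_quotient_pre //; apply/Oup_subP=> x Kx p'x.
  have Nx := subsetP nWK x Kx; apply: mem_morphpre => //=; apply: mem_Oup; last exact: morph_p_elt.
  by have [] := morphpreP Kx.
split=> //; rewrite -sub_quotient_pre ?(subset_trans sAG) //.
rewrite -sub_quotient_pre ?(subset_trans (quotientS W sAG)) //.
apply/subsetP=> _ /morphimP[ab nCa /morphimP[a nWa Aa def_ab] ->].
have Ga := subsetP sAG a Aa; rewrite /= in def_ab.
have Gab : ab \in G / W by rewrite def_ab mem_quotient.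
have qa e : e \in U / W -> [~ e, ab, ab] = 1.
  case/morphimP=> u nWu Uu ->; rewrite def_ab -!morphR ?groupR //=; apply: coset_id.
  by rewrite (subsetP qA) // !mem_commg.
apply: Baer_Suzuki => [|_ /morphimP[y nCy Gy ->]]; first exact: mem_quotient.
have Gaby : ab ^ y \in G / W by rewrite groupJ.
have sHC : Oup p <<[set ab; ab ^ y]>>%G \subset 'C(U / W).
  apply: (quadratic_pair_cent p_pr p_gt2 frGb nsE abE) => //.
  by apply: quadratic_conj qa; rewrite (subsetP nEG).
have sHG : <<[set ab; ab ^ y]>> \subset G / W.
  by rewrite gen_subG; apply/subsetP=> z /set2P[] ->.
have pH : p.-group (<<[set ab; ab ^ y]>>%G / C).
  by rewrite -Oup_sub_quo ?(subset_trans sHG) // subsetI (subset_trans (Oup_sub p _)).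
apply: pgroupS pH; rewrite gen_subG; apply/subsetP=> z /set2P[] ->.
  by rewrite mem_quotient // mem_gen // !inE eqxx.
by rewrite -morphJ //= mem_quotient // mem_gen // !inE eqxx orbT.
Qed.

End PStable.

(** * Members of the limit set lie in O_p(G) *)

Section KinftyPcore.

Variables (p : nat) (gT : finGroupType).
Implicit Types (A C G H K M N S U W X Y : {group gT}).

Hypotheses (p_pr : prime p) (p_gt2 : 2 < p).

Lemma Qd_freeS G H : H \subset G -> Qd_free p G -> Qd_free p H.
Proof. by move=> sHG frG K L nKL sLH; apply: frG (subset_trans sLH sHG). Qed.

Lemma exists_min_noncentral X N C0 :
    C0 <| X -> [~: C0, N] != 1 ->
  exists C : {group gT},
    [/\ C \subset C0, X \subset 'N(C), [~: C, N] != 1 &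
     forall C1 : {group gT}, C1 \proper C -> X \subset 'N(C1) -> [~: C1, N] = 1].
Proof.
move=> /andP[sC0X nC0X] ntN.
have [|C /mingroupP[/and3P[sC nC nt] minC] _] :=
  @mingroup_exists _ (fun C => [&& C \subset C0, X \subset 'N(C) & [~: C, N] != 1]) C0.
  by rewrite /= subxx nC0X.
exists C; split=> // C1 prC1 nC1; apply/eqP; apply: contraTT (prC1) => ntC1.
have sC1 := proper_sub prC1; have sC10 := subset_trans sC1 sC; suffices ->: C1 :=: C by rewrite properxx.
by apply: minC sC1; rewrite ntC1 nC1 sC10.
Qed.

(** X / O^p(X) is a p-group, so a proper subgroup of it lies in a maximal one, which is normal; its
    preimage would be a proper normal subgroup containing A. *)
Lemma mul_pgroup_supplement X A :
    A \subset X ->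
    (forall M, M <| X -> A \subset M -> M :=: X) ->
  Oup p X <*> A = X.
Proof.
move=> sAX maxA; have nsO := Oup_normal p X; have [sOX nOX] := andP nsO.
have sHX : Oup p X <*> A \subset X by rewrite join_subG sOX.
pose H := (Oup p X <*> A)%G; have sOH : Oup p X \subset H := joing_subl _ _.
have := maximal_exists (quotientS (Oup p X) sHX).
case=> [eqH | [M maxM sHM]].
  by apply/eqP; rewrite eqEsubset sHX -(quotientSGK nOX sOH) /= eqH.
have nsM := p_maximal_normal (Oup_pgroup_quo p X) maxM.
have nsM' : coset (Oup p X) @*^-1 M <| X.
  by have := nsM; rewrite -cosetpre_normal quotientGK.
have sHM' : H \subset coset (Oup p X) @*^-1 M.
  by rewrite -sub_quotient_pre // (subset_trans sHX).
have /(congr1 (fun Z => Z / Oup p X)) := maxA _ nsM' (subset_trans (joing_subr _ _) sHM').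
by have := maxgroupp maxM; rewrite cosetpreK => /[swap] -> /[!properxx].
Qed.

Section CommutatorCondition.

Variables A C0 : {group gT}.
Hypotheses (pA : p.-group A) (pC0 : p.-group C0).
Hypotheses (clA : [~: A, A] \subset 'Z(A)) (nAC0 : C0 \subset 'N(A)).
Hypothesis qA : forall B : {group gT}, B \subset C0 ->
  [~: A, B, B] \subset 'Z(A) -> [~: A, B] \subset 'Z(A).

Lemma quadratic_pcore_aux X :
    Qd_free p X -> A \subset X -> C0 <| X ->
    (forall M, M <| X -> A \subset M -> C0 \subset M -> M :=: X) ->
  [~: C0, Oup p X] = 1.
Proof.
move=> frX sAX nsC0 maxAC; have [sC0X nC0X] := andP nsC0.
have defX : Oup p X <*> (A <*> C0) = X.
  apply: mul_pgroup_supplement => [|M nsM]; first by rewrite join_subG sAX.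
  by rewrite join_subG => /andP[]; apply: maxAC.
apply/eqP/idPn => /(exists_min_noncentral nsC0)[C [sCC0 nCX ntC minC]].
have pC := pgroupS sCC0 pC0; have sCX := subset_trans sCC0 sC0X.
have nOX := subset_trans (normG X) (Oup_norm p X).
have subZ := min_noncentral_sub pC sCX nCX (subxx X) nOX ntC minC.
have defC := min_noncentral_comm pC nCX (subxx X) nOX ntC minC.
have sPZ := min_noncentral_Phi pC sCX nCX (subxx X) nOX ntC minC.
have ntC1 := min_noncentral_neq1 ntC.
have nsC : C <| X by rewrite /normal sCX.
have nAC : C \subset 'N(A) := subset_trans sCC0 nAC0.
have nCA : A \subset 'N(C) := subset_trans sAX nCX.
(* p-stability gives a normal K containing A with [C, O^p(K)] <= W. By the choice of X, K C0 = X, so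
   O^p(X) <= O^p(K) and C = [C, O^p(X)] <= W. *)
have noquad W : W \proper C -> W <| X -> 'Phi(C) \subset W -> [~: C, A, A] \subset W -> False.
  move=> prW nsW sPW qC; have sWC := proper_sub prW.
  have abCW : p.-abelem (C / W).
    by apply: min_noncentral_abelem => //; apply: subset_trans sCX (normal_norm nsW).
  have [K [nsK sAK] sW] := p_stable p_pr p_gt2 frX nsC nsW sWC pC abCW sAX pA qC.
  have nKC0 := subset_trans sC0X (normal_norm nsK).
  have defK : K <*> C0 = X.
    apply: maxAC; rewrite ?joing_subr ?normalY //.
    exact: subset_trans (joing_subl _ _).
  have sOK : Oup p X \subset Oup p K.
    apply/Oup_subP=> x Xx p'x; apply: mem_Oup => //.
    have: Oup p X \subset K.
      by rewrite Oup_sub_quo ?normal_norm // -defK quotientYidl // quotient_pgroup.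
    by move/Oup_subP; apply.
  have := properxx C; rewrite (sub_proper_trans _ prW) //.
  by apply: subset_trans sW; rewrite -{1}defC commgS.
have prPhi := Phi_proper ntC1.
have nsPhi : 'Phi(C) <| X := char_normal_trans (Phi_char C) nsC.
have noquad1 : [~: A, C] \subset 'Z(A) -> False.
  move=> sACZ; apply: noquad prPhi nsPhi (subxx _) _.
  have /commG1P -> : [~: C, A] \subset 'C(A); last exact: sub1G.
  by rewrite commGC (subset_trans sACZ) ?subsetIr.
have nsZC : 'Z(C) <| X := char_normal_trans (center_char C) nsC.
pose Y1 := ('C_('Z(C))(A))%G.
have sY1Z : Y1 \subset 'Z(C) by apply: subsetIl.
have sY1C : Y1 \subset C := subset_trans sY1Z (center_sub C).
case/boolP: (abelian C) => [cCC|ncCC].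
  apply/noquad1/(qA sCC0); have /commG1P -> : [~: A, C] \subset 'C(C); last exact: sub1G.
  by apply: subset_trans cCC; rewrite commg_subr.
have prZ : 'Z(C) \proper C.
  by rewrite properE center_sub; apply: contra ncCC; rewrite subsetI => /andP[].
have cZO : Oup p X \subset 'C('Z(C)).
  by rewrite centsC; apply/commG1P/minC; last exact: normal_norm.
(* X is generated by O^p(X), A and C0; the first two centralise Y1. *)
have nY1X : X \subset 'N(Y1).
  rewrite -defX !join_subG; apply/and3P; split.
  - by apply: cents_norm; rewrite (subset_trans cZO) ?centS.
  - apply: cents_norm; rewrite centsC; exact: subsetIr.
  by rewrite normsI ?(subset_trans sC0X (normal_norm nsZC)) ?norms_cent.
have nY1C := subset_trans sCX nY1X.
(* If C1 < C then [C, A, A] <= C1 <= Z(C); if C1 = C then [A, C, C] <= Z(A). *)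
pose C1 := (coset Y1 @*^-1 'Z(C / Y1) :&: C)%G.
have nC1X : X \subset 'N(C1).
  rewrite normsI //; apply: subset_trans (morphpre_norm _ _).
  rewrite -sub_quotient_pre //; apply: subset_trans (quotient_norms _ nCX) _.
  exact: char_norms (center_char _).
have subC1 (H : {group gT}) : H \subset C -> [~: H, C] \subset Y1 -> H \subset C1.
  move=> sHC HC; rewrite subsetI sHC andbT -sub_quotient_pre ?(subset_trans sHC) //.
  rewrite subsetI quotientS //= quotient_cents2 ?(subset_trans sHC) //.
case/boolP: (C1 \proper C) => [prC1|].
  apply: (noquad ('Z(C))%G) => //.
  apply: subset_trans (subZ _ prC1 nC1X); pose E := [~: C, A, A]%G.
  have sDC : [~: C, A] \subset C by rewrite commg_subl.
  have sEC : E \subset C.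
    by rewrite (subset_trans (commSg A sDC)) // commg_subl.
  have sDA : [~: C, A] \subset A by rewrite commg_subr.
  have sEZ : E \subset 'Z(A) by rewrite (subset_trans (commSg A sDA)).
  have cAE : [~: A, E] = 1.
    by apply/commG1P; rewrite centsC (subset_trans sEZ) ?subsetIr.
  apply: (subC1 E) => //; rewrite subsetI.
  (* Three subgroups: [C, A] <= A and E <= Z(A). *)
  have ECA : [~: E, C, A] = 1.
    apply: three_subgroup; last by rewrite cAE comm1G.
    by apply/trivgP; rewrite -cAE commSg.
  have sCC' : [~: E, C] \subset 'Z(C).
    apply: subset_trans (commSg C sEC) _; rewrite -derg1.
    by apply: subset_trans sPZ; rewrite (Phi_joing pC) joing_subl.
  by rewrite sCC' /=; apply/commG1P.
rewrite properE subsetIr negbK => sCC1; apply/noquad1/(qA sCC0).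
have sCCY : [~: C, C] \subset Y1.
  rewrite -quotient_cents2 //; move: sCC1; rewrite subsetI -sub_quotient_pre //.
  by rewrite subsetI => /andP[/andP[]].
have sAC_A : [~: A, C] \subset A by rewrite commg_subl.
have sAC_C : [~: A, C] \subset C by rewrite commg_subr.
rewrite subsetI (subset_trans (commSg C sAC_A)) //=.
apply: subset_trans (commSg C sAC_C) _; apply: subset_trans sCCY _.
exact: subsetIr.
Qed.

(** Induction on |X|: a proper normal subgroup M containing A and C0 can replace X, as O_p of M
    modulo the centraliser of C0 lies in O_p of X modulo it. *)
Lemma quadratic_pcore X :
    Qd_free p X -> A \subset X -> C0 <| X ->
  A / 'C(C0) \subset 'O_p(X / 'C(C0)).
Proof.
have [n] := ubnP #|X|; elim: n X => // n IHn X /ltnSE leXn frX sAX nsC0.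
have [sC0X nC0X] := andP nsC0.
case: (boolP [forall M : {group gT}, [&& M <| X, A \subset M & C0 \subset M] ==> (M :==: X)]).
  move/forallP=> maxAC; have nCX : X \subset 'N('C(C0)) by apply: norms_cent.
  have pX : p.-group (X / 'C(C0)).
    rewrite -Oup_sub_quo //; rewrite centsC; apply/commG1P.
    apply: quadratic_pcore_aux => // M nsM sAM sCM; apply/eqP.
    by apply: (implyP (maxAC M)); rewrite nsM sAM.
  by rewrite pcore_pgroup_id // quotientS.
rewrite negb_forall => /existsP[M]; rewrite negb_imply => /andP[/and3P[nsM sAM sCM] neM].
have sMX := normal_sub nsM.
apply: subset_trans (IHn M _ _ sAM _) _.
- apply: leq_trans leXn; apply: proper_card; rewrite properEneq sMX andbT.
  by apply: contraNneq neM => /= eM; apply/eqP.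
- exact: Qd_freeS frX.
- exact: normalS nsC0.
apply: pcore_max (pcore_pgroup _ _) _.
exact: char_normal_trans (pcore_char _ _) (quotient_normal _ nsM).
Qed.

End CommutatorCondition.

(** p-stability gives a normal K containing X with [C, O^p(K)] <= Z(C). If [C, K] Z(C) < C,
    minimality puts it in Z(C). Otherwise a Sylow p-subgroup T of K satisfies [C, T] Z(C) = C, and
    nilpotence of C T forces C = Z(C). *)
Lemma min_noncentral_quadratic G M C X :
    Qd_free p G -> p.-group C -> C <| G -> M <| G ->
    [~: C, Oup p M] != 1 ->
    (forall C1, C1 \proper C -> G \subset 'N(C1) -> [~: C1, Oup p M] = 1) ->
    X \subset G -> p.-group X ->
  [~: C, X, X] \subset 'Z(C) -> [~: C, X] \subset 'Z(C).
Proof.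
move=> frG pC nsC nsM ntC minC sXG pX qX; have [sCG nCG] := andP nsC.
have [sMG nMG] := andP nsM.
have nNG : G \subset 'N(Oup p M) := subset_trans nMG (Oup_norm p M).
have sPZ := min_noncentral_Phi pC sCG nCG sMG nNG ntC minC.
have subZ := min_noncentral_sub pC sCG nCG sMG nNG ntC minC.
have nsZ : 'Z(C) <| G := char_normal_trans (center_char C) nsC.
have abZ : p.-abelem (C / 'Z(C)).
  by apply: min_noncentral_abelem => //; apply: subset_trans sCG (normal_norm nsZ).
have [K [nsK sXK] sW] := p_stable p_pr p_gt2 frG nsC nsZ (center_sub C) pC abZ sXG pX qX.
have [sKG nKG] := andP nsK; have nCK := subset_trans sKG nCG.
have nZG := normal_norm nsZ; have nZC := subset_trans sCG nZG.
apply: subset_trans (commgS C sXK) _.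
pose C1 := ([~: C, K] <*> 'Z(C))%G.
have sC1C : C1 \subset C by rewrite join_subG commg_subl nCK center_sub.
have nC1 : G \subset 'N(C1) by rewrite normsY // normsR.
case/boolP: (C1 \proper C) => [prC1 | ].
  by apply: subset_trans (subZ _ prC1 nC1); apply: joing_subl.
rewrite properE sC1C negbK => sCC1.
have [T sylT] := Sylow_exists p K; have [sTK pT _] := and3P sylT.
have sTG := subset_trans sTK sKG.
have nOK := normal_norm (Oup_normal p K).
have defK : Oup p K * T = K.
  rewrite -norm_joinEr ?(subset_trans sTK) //.
  apply/eqP; rewrite eqEsubset join_subG Oup_sub sTK /=.
  rewrite -(quotientSGK nOK (joing_subl _ _)) /= quotientYidl ?(subset_trans sTK) //.
  by rewrite (pHall_id (quotient_pHall (subset_trans sTK nOK) sylT)) ?Oup_pgroup_quo.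
have [sOK nZK] := (Oup_sub p K, subset_trans sKG nZG).
have cOC : Oup p K / 'Z(C) \subset 'C(C / 'Z(C)).
  rewrite centsC; apply/commG1P; rewrite -quotientR ?(subset_trans sOK) //.
  by apply/trivgP; rewrite quotient_sub1 // (subset_trans sW) ?normG.
have eqC : C / 'Z(C) \subset [~: C / 'Z(C), T / 'Z(C)].
  have: C / 'Z(C) \subset [~: C / 'Z(C), K / 'Z(C)].
    have nZR : [~: C, K] \subset 'N('Z(C)) by rewrite (subset_trans _ nZC) // commg_subl.
    by rewrite -quotientR // -(quotientYidr nZR) quotientS.
  move/subset_trans; apply; rewrite gen_subG; apply/subsetP=> _ /imset2P[c k Cc Kk ->].
  move: Kk; rewrite -defK quotientMl ?(subset_trans sOK) // => /mulsgP[o t Oo Tt ->].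
  have /commgP/eqP co : commute c o by apply/esym/(centsP cOC).
  by rewrite commgMJ co conj1g mulg1 mem_commg.
have nCT := subset_trans sTK nCK.
have pCT : p.-group (C <*> T / 'Z(C)).
  by apply: quotient_pgroup; rewrite /= norm_joinEr // pgroupM pC.
have trC : C / 'Z(C) = 1.
  apply/eqP/idPn => nt1; have := nil_comm_properl (A := T / 'Z(C)) (pgroup_nil pCT) _ nt1 _.
  rewrite quotientS ?joing_subl // subsetI quotientS ?joing_subr // quotient_norms //.
  by move=> /(_ isT isT); rewrite properE eqC andbF.
apply: subset_trans (_ : C \subset _); first by rewrite commg_subl.
by rewrite -quotient_sub1 // trC.
Qed.

Theorem Kinfty_set_pcore G S A :
    Qd_free p G -> has_characteristic p G ->
    S \subset G -> p.-group S -> 'O_p(G) \subset S ->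
  A \in Kinfty_set S -> A \subset 'O_p(G).
Proof.
move=> frG chG sSG pS sQS KA.
(* In this form the condition on A can be tested on any member of [Kop S (Kinfty_set S)], such as
   the C found below. *)
have /KopP[sAS clA nAB qA] : A \in Kop S (Kop S (Kinfty_set S)) by rewrite Kinfty_set_fix.
have sAG := subset_trans sAS sSG; have pA := pgroupS sAS pS.
pose M := <<class_support A G>>%G.
have sAM : A \subset M by rewrite sub_gen ?sub_class_support.
have nsM : M <| G.
  by rewrite /normal gen_subG class_support_subG // norms_gen ?class_support_norm.
have minM H : A \subset H -> G \subset 'N(H) -> M \subset H.
  by move=> sAH nHG; rewrite gen_subG class_support_sub_norm.
have [sMG nMG] := andP nsM; have nNG := subset_trans nMG (Oup_norm p M).
have pQ : p.-group 'O_p(G) := pcore_pgroup p G.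
case: (eqVneq [~: 'O_p(G), Oup p M] 1) => [cQN | ].
  (* O^p(M) centralises O_p(G), hence lies in it. Being a p-group generated by p'-elements it is
     trivial, so M is a normal p-subgroup. *)
  have sNQ : Oup p M \subset 'O_p(G).
    apply: subset_trans chG; rewrite subsetI (subset_trans (Oup_sub p M)) //.
    by rewrite centsC; apply/commG1P.
  have pM : p.-group M.
    rewrite -Oup1_pgroup; apply/Oup_subP=> x Mx p'x; have Qx := subsetP sNQ x (mem_Oup Mx p'x).
    by rewrite inE -order_eq1 (@pnat_1 p #[x]) //; apply: mem_p_elt pQ Qx.
  by apply: subset_trans sAM _; apply: pcore_max.
case/(exists_min_noncentral (pcore_normal p G)) => C [sCQ nCG ntC minC].
have pC := pgroupS sCQ pQ; have sCG := subset_trans sCQ (pcore_sub p G).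
have nsC : C <| G by apply/andP.
have KsS B : B \in Kinfty_set S -> B \subset S := @mem_Kinfty_sub _ S B.
have KC : C \in Kop S (Kinfty_set S).
  apply/KopP; split=> [||B KB|B D KD sBD].
  - exact: subset_trans sCQ sQS.
  - rewrite nil_class2.
    apply: subset_trans _ (min_noncentral_Phi pC sCG nCG sMG nNG ntC minC).
    by rewrite (Phi_joing pC) joing_subl.
  - exact: subset_trans (subset_trans (KsS B KB) sSG) nCG.
  have sBS := subset_trans sBD (KsS D KD).
  exact: min_noncentral_quadratic frG pC nsC nsM ntC minC (subset_trans sBS sSG) (pgroupS sBS pS).
have /= AO : A / 'C(C) \subset 'O_p(G / 'C(C)).
  apply: quadratic_pcore => //; first by rewrite -derg1 -nil_class2.
    exact: nAB KC.
  by move=> B sBC; apply: qA KC sBC.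
have nCC : G \subset 'N('C(C)) by apply: norms_cent.
case/negP: ntC; apply/eqP/commG1P; rewrite centsC Oup_sub_quo ?(subset_trans sMG nCC) //.
apply: pgroupS (pcore_pgroup p (G / 'C(C))).
rewrite sub_quotient_pre ?(subset_trans sMG nCC) //.
apply: (minM (coset 'C(C) @*^-1 'O_p(G / 'C(C)))%G).
  by rewrite -sub_quotient_pre // (subset_trans sAG).
apply: subset_trans (morphpre_norm _ _); rewrite -sub_quotient_pre //.
exact/normal_norm/pcore_normal.
Qed.

End KinftyPcore.

Theorem corollaryD (p : nat) (gT : finGroupType) (G S : {group gT}) :
  prime p -> 3 <= p ->
  Qd_free p G -> has_characteristic p G ->
  S \subset G -> p.-group S -> 'O_p(G) \subset S ->
  Kinfty S <| G.
Proof.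
move=> p_pr p_ge3 frG chG sSG pS sQS.
have eqK : Kinfty S = Kinfty 'O_p(G).
  rewrite /Kinfty (Kinfty_set_restrict sQS) // => A.
  exact: (Kinfty_set_pcore p_pr p_ge3 frG chG).
rewrite eqK /normal (subset_trans (Kinfty_sub _) (pcore_sub _ _)).
exact: subset_trans (normal_norm (pcore_normal p G)) (Kinfty_norm _).
Qed.
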